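(* Let $\mathcal{L}\subset\mathbb{P}^2_{\mathbb{R}}$ be a non-trivial free real line arrangement of $d$ lines all of whose intersection points have multiplicity at most $4$. Then $3\le d\le 18$ and the triple $(n_2,n_3,n_4)$ is one of those listed for the corresponding $d$: \begin{itemize} \item $d=3$: $(3,0,0)$; \item $d=4$: $(3,1,0)$; \item $d=5$: $(4,0,1)$, $(4,2,0)$; \item $d=6$: $(3,4,0)$, $(6,1,1)$; \item $d=7$: $(3,6,0)$, $(6,1,2)$, $(6,3,1)$, $(9,0,2)$; \item $d=8$: $(4,6,1)$, $(7,1,3)$, $(7,3,2)$, $(10,0,3)$; \item $d=9$: $(6,4,3)$, $(6,6,2)$, $(9,1,4)$, $(9,3,3)$, $(12,0,4)$; \item $d=10$: $(6,7,3)$, $(9,0,6)$, $(9,2,5)$, $(9,4,4)$, $(12,1,5)$; \item $d=11$: $(7,8,4)$, $(10,1,7)$, $(10,3,6)$, $(10,5,5)$, $(13,0,7)$, $(13,2,6)$; \item $d=12$: $(9,7,6)$, $(12,0,9)$, $(12,2,8)$, $(12,4,7)$, $(15,1,8)$; \item $d=13$: $(12,4,9)$, $(12,6,8)$, $(15,1,10)$, $(15,3,9)$, $(18,0,10)$; \item $d=14$: $(13,6,10)$, $(16,1,12)$, $(16,3,11)$, $(19,0,12)$; \item $d=15$: $(15,6,12)$, $(18,1,14)$, $(18,3,13)$, $(21,0,14)$; \item $d=16$: $(18,4,15)$, $(21,1,16)$; \item $d=17$: $(22,0,19)$, $(22,2,18)$; \item $d=18$: $(24,1,21)$. \end{itemi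ze}
   Context: A line arrangement of $d$ lines is a finite set of $d$ distinct lines in the projective plane. An intersection point is $k$-fold (has multiplicity $k$) if exactly $k$ lines of the arrangement pass through it; $n_k$ denotes the number of $k$-fold intersection points. An arrangement is trivial if it is a pencil, i.e. all its lines pass through one common point. Freeness: let $S=\mathbb{C}[x,y,z]$. A reduced curve $C=\{f=0\}\subset\mathbb{P}^2_{\mathbb{C}}$, with $f\in S$ homogeneous of degree $d$, is free if its Jacobian ideal $J_f=\langle \partial_x f,\partial_y f,\partial_z f\rangle$ is saturated with respect to $\mathfrak{m}=\langle x,y,z\rangle$. A line arrangement is regarded as the reduced curve defined by the product $f$ of the linear forms defining its lines. A real line arrangement is called free if it is free when regarded as an arrangement in $\mathbb{P}^2_{\mathbb{C}}$ via $\mathbb{R}\subset\mathbb{C}$ (same linear forms). The list gives necessary conditions only: it is not asserted that every listed triple is realized by an arrangement. *)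

(* Defs.v *)
From mathcomp Require Import all_boot all_order all_algebra.
From mathcomp Require Import finmap boolp classical_sets functions cardinality.
From mathcomp Require Import reals.
From mathcomp Require Import complex mpoly.

Set Implicit Arguments.
Unset Strict Implicit.
Unset Printing Implicit Defensive.

Import GRing.Theory.
Local Open Scope fset_scope.
Local Open Scope classical_set_scope.
Local Open Scope ring_scope.

Section Plane.
Variable K : fieldType.

Definition point := {U : {vspace 'rV[K]_3} | \dim U == 1%N}.
Definition line := {U : {vspace 'rV[K]_3} | \dim U == 2%N}.

Definition on_line (P : point) (H : line) : bool := (val P <= val H)%VS.

Definition mult (A : {fset line}) (P : point) : nat :=
  #|` [fset H in A | on_line P H]|.

(* A set of points that is infinite would be sent to fset0 by fset_set; this
   does not happen for 2 <= k, by finite_mult below. *)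
Definition npts (A : {fset line}) (k : nat) : nat :=
  #|` fset_set [set P : point | mult A P = k]|.

Definition trivial_arr (A : {fset line}) : Prop :=
  exists P : point, forall H, H \in A -> on_line P H.

(* For the line H, whose dimension is 2, this forces a to be nonzero. *)
Definition defines (a : 'rV[K]_3) (H : line) : Prop :=
  forall v : 'rV[K]_3, (v \in val H) = (\sum_(i < 3) a 0 i * v 0 i == 0).

Lemma finite_mult (A : {fset line}) (k : nat) :
  (1 < k)%N -> finite_set [set P : point | mult A P = k].
Proof.
move=> k_gt1.
case: (pselect (exists P0 : point, True)) => [[P0 _]|noP]; last first.
  rewrite (_ : [set P | _] = classical_sets.set0) //; apply/seteqP; split=> // P _.
  by case: noP; exists P.
pose meet (u : line * line) : point := insubd P0 (val u.1 :&: val u.2)%VS.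
apply: (@sub_finite_set _ _ [set` [fset meet u | u in (A `*` A)%fset]%fset]); last first.
  exact: finite_fset.
move=> P /= multP.
have : (1 < #|` [fset H in A | on_line P H]|)%N by rewrite -/(mult A P) multP.
set B := [fset _ in _ | _] => B_gt1.
have [H HB] : exists H, H \in B.
  by apply/fset0Pn; rewrite -cardfs_gt0 (ltn_trans _ B_gt1).
have [H' H'B] : exists H', H' \in (B `\ H)%fset.
  apply/fset0Pn; rewrite -cardfs_gt0.
  by move: B_gt1; rewrite (cardfsD1 H) HB.
move: HB H'B; rewrite !inE /= => /andP[HA PH] /and3P[neqH H'A PH'].
apply/imfsetP; exists (H, H'); first by rewrite /= !inE /= HA H'A.
apply: val_inj; have /eqP dP := valP P; have /eqP dH := valP H.
have /eqP dH' := valP H'.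
have sub : (val P <= val H :&: val H')%VS by rewrite subv_cap; apply/andP.
have dim_lt : (\dim (val H :&: val H') < 2)%N.
  rewrite ltnNge; apply/negP => dge; move/negP: neqH; apply; apply/eqP.
  have e1 : (val H :&: val H')%VS = val H.
    by apply/eqP; rewrite eqEdim capvSl dH.
  have e2 : (val H :&: val H')%VS = val H'.
    by apply/eqP; rewrite eqEdim capvSr dH'.
  by apply: val_inj; rewrite -e2 e1.
have e : val P = (val H :&: val H')%VS.
  by apply/eqP; rewrite eqEdim sub dP -ltnS.
by rewrite /meet val_insubd /= -e dP eqxx.
Qed.

End Plane.

Section Ideals.
Variable S : comNzRingType.

Definition ideal_span (G : set S) : set S :=
  [set p | exists2 s : seq (S * S),
     forall u, u \in s -> G u.2 & p = \sum_(u <- s) u.1 * u.2].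

Fixpoint ideal_pow (I : set S) (N : nat) : set S :=
  if N is N'.+1 then
    ideal_span [set p | exists a b, [/\ I a, ideal_pow I N' b & p = a * b]]
  else [set: S].

(* The saturation of I is the union over N of the colon ideals (I : m^N). *)
Definition saturation (I m : set S) : set S :=
  [set g | exists N, forall h, ideal_pow m N h -> I (h * g)].

Definition saturated (I m : set S) : Prop := saturation I m = I.

End Ideals.

Section Freeness.
Variable K : fieldType.

Definition jacobian_ideal (f : {mpoly K[3]}) : set {mpoly K[3]} :=
  ideal_span [set p | exists i : 'I_3, p = mderiv i f].

Definition irrelevant_ideal : set {mpoly K[3]} :=
  ideal_span [set p | exists i : 'I_3, p = 'X_i].

Definition free_curve (f : {mpoly K[3]}) : Prop :=
  saturated (jacobian_ideal f) irrelevant_ideal.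

Definition linform (a : 'rV[K]_3) : {mpoly K[3]} :=
  \sum_(i < 3) a 0 i *: 'X_i.

End Freeness.

(* Each linear form is determined up to a nonzero factor, which does not affect
   the Jacobian ideal of the product, so the choice of ell is immaterial. *)
Definition free_real_arr (R : realType) (A : {fset line R}) : Prop :=
  exists2 ell : line R -> 'rV[R]_3,
    forall H, H \in A -> defines (ell H) H &
    free_curve (\prod_(H <- A) linform (map_mx (@real_complex R) (ell H))).

Definition admissible_triples (d : nat) : seq (nat * nat * nat) :=
  match d with
  | 3 => [:: (3, 0, 0)]
  | 4 => [:: (3, 1, 0)]
  | 5 => [:: (4, 0, 1); (4, 2, 0)]
  | 6 => [:: (3, 4, 0); (6, 1, 1)]
  | 7 => [:: (3, 6, 0); (6, 1, 2); (6, 3, 1); (9, 0, 2)]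
  | 8 => [:: (4, 6, 1); (7, 1, 3); (7, 3, 2); (10, 0, 3)]
  | 9 => [:: (6, 4, 3); (6, 6, 2); (9, 1, 4); (9, 3, 3); (12, 0, 4)]
  | 10 => [:: (6, 7, 3); (9, 0, 6); (9, 2, 5); (9, 4, 4); (12, 1, 5)]
  | 11 => [:: (7, 8, 4); (10, 1, 7); (10, 3, 6); (10, 5, 5); (13, 0, 7);
              (13, 2, 6)]
  | 12 => [:: (9, 7, 6); (12, 0, 9); (12, 2, 8); (12, 4, 7); (15, 1, 8)]
  | 13 => [:: (12, 4, 9); (12, 6, 8); (15, 1, 10); (15, 3, 9); (18, 0, 10)]
  | 14 => [:: (13, 6, 10); (16, 1, 12); (16, 3, 11); (19, 0, 12)]
  | 15 => [:: (15, 6, 12); (18, 1, 14); (18, 3, 13); (21, 0, 14)]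
  | 16 => [:: (18, 4, 15); (21, 1, 16)]
  | 17 => [:: (22, 0, 19); (22, 2, 18)]
  | 18 => [:: (24, 1, 21)]
  | _ => [::]
  end%N.

(* Main.v *)
(* Let b be the sum of (multiplicity - 1) over the intersection points.  The
   listed triples are the solutions of
     n2 + 3 n3 + 6 n4 = d (d - 1) / 2,  b <= (d - 1) + (d - 1)^2 / 4,  n4 + 3 <= n2
   other than (27, 0, 24) for d = 19, which is ruled out separately.

   Freeness enters only through the second condition, in the form that the
   total Tjurina number d (d - 1) - b is at least 3/4 (d - 1)^2.  On the one
   hand, adding lines one at a time shows that the Jacobian ideal J has
   codimension at most d (d - 1) - b in all large degrees.  On the other hand, a
   linear form vanishing at no intersection point generates with J an ideal
   containing a power of the irrelevant ideal, so that it is regular modulo the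
   saturated ideal J and the codimension of J is nondecreasing in the degree.
   In degree about 3/2 (d - 1) the codimension is at least 3/4 (d - 1)^2 simply
   because J has three generators.

   The third condition is Melchior's inequality.  A chamber is a set of signs
   realized by a vector; by deletion and restriction there are 2 (b + 1) of
   them, and each has at least three walls.  For (27, 0, 24) Melchior's
   inequality is an equality, so all chambers are triangles; none of them has
   two double points as vertices, hence the 4 n2 = 108 triangles at double
   points are distinct, but there are only b + 1 = 100 triangles. *)
Require Import Defs.
From mathcomp Require Import all_boot all_order all_algebra.
From mathcomp Require Import finmap reals boolp complex mpoly.
From mathcomp Require Import zify ring lra.

Set Implicit Arguments.
Unset Strict Implicit.
Unset Printing Implicit Defensive.

Import Order.TTheory GRing.Theory Num.Theory.

(** * Cross products in three-space *)

Section Vec3.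
Local Open Scope ring_scope.
Variable K : comNzRingType.
Implicit Types a b c v : 'rV[K]_3.

Definition dot a v : K := \sum_(i < 3) a 0 i * v 0 i.

(** Indices in ['I_3] are added modulo 3, so one formula covers the three coordinates. *)
Definition cross a b : 'rV[K]_3 :=
  \row_(i < 3) (a 0 (i + 1) * b 0 (i + 2%:R) - a 0 (i + 2%:R) * b 0 (i + 1)).

(** The determinant of three vectors. Over a field it vanishes exactly when the three lines have a
    common point. *)
Definition vol a b c := dot (cross a b) c.

Lemma sum3 (V : nmodType) (F : 'I_3 -> V) :
  \sum_(i < 3) F i = F 0 + F 1 + F 2%:R.
Proof.
rewrite !big_ord_recl big_ord0 addr0 addrA.
by congr (_ + _ + F _); [congr F|]; apply: val_inj.
Qed.

Lemma ord3P (Q : 'I_3 -> Prop) : Q 0 -> Q 1 -> Q 2%:R -> forall i, Q i.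
Proof.
move=> q0 q1 q2 [[|[|[|//]]] lt_i].
- by rewrite (_ : Ordinal _ = 0) //; apply: val_inj.
- by rewrite (_ : Ordinal _ = 1) //; apply: val_inj.
- by rewrite (_ : Ordinal _ = 2%:R) //; apply: val_inj.
Qed.

Lemma ord3_add : prod (prod (1 + 1 = 2%:R :> 'I_3) (1 + 2%:R = 0 :> 'I_3))
  (prod (2%:R + 1 = 0 :> 'I_3) (2%:R + 2%:R = 1 :> 'I_3)).
Proof. by do !split; apply: val_inj. Qed.

Lemma crossE a b : prod (cross a b 0 0 = a 0 1 * b 0 2%:R - a 0 2%:R * b 0 1)
  (prod (cross a b 0 1 = a 0 2%:R * b 0 0 - a 0 0 * b 0 2%:R)
  (cross a b 0 2%:R = a 0 0 * b 0 1 - a 0 1 * b 0 0)).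
Proof. by rewrite !mxE !ord3_add !add0r. Qed.

Lemma dotE a v : dot a v = a 0 0 * v 0 0 + a 0 1 * v 0 1 + a 0 2%:R * v 0 2%:R.
Proof. by rewrite /dot sum3. Qed.

Lemma row3P a b : a 0 0 = b 0 0 -> a 0 1 = b 0 1 -> a 0 2%:R = b 0 2%:R -> a = b.
Proof. by move=> e0 e1 e2; apply/rowP; apply: ord3P. Qed.

Lemma dotC a v : dot a v = dot v a.
Proof. by rewrite !dotE; ring. Qed.

Lemma dotDr a v w : dot a (v + w) = dot a v + dot a w.
Proof. by rewrite !dotE !mxE; ring. Qed.

Lemma dotZr a (k : K) v : dot a (k *: v) = k * dot a v.
Proof. by rewrite !dotE !mxE; ring. Qed.

Lemma dotNr a v : dot a (- v) = - dot a v.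
Proof. by rewrite !dotE !mxE; ring. Qed.

Lemma dot0r a : dot a 0 = 0.
Proof. by rewrite !dotE !mxE; ring. Qed.

Lemma dotZl a (k : K) v : dot (k *: v) a = k * dot v a.
Proof. by rewrite !dotE !mxE; ring. Qed.

Lemma dot_crossl a b : dot a (cross a b) = 0.
Proof. by rewrite !dotE !crossE; ring. Qed.

Lemma dot_crossr a b : dot b (cross a b) = 0.
Proof. by rewrite !dotE !crossE; ring. Qed.

Lemma crossC a b : cross a b = - cross b a.
Proof. by apply: row3P; rewrite !mxE ?add0r ?ord3_add; ring. Qed.

Lemma vol_rot a b c : vol a b c = vol b c a.
Proof. by rewrite /vol !dotE !crossE; ring. Qed.

Lemma cross_cross a b c : cross a (cross b c) = dot a c *: b - dot a b *: c.
Proof. by apply: row3P; rewrite ?crossE !dotE !mxE ?add0r ?ord3_add; ring. Qed.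

Lemma cramer3 a b c v :
  vol a b c *: v = dot v (cross b c) *: a + dot v (cross c a) *: b + dot v (cross a b) *: c.
Proof.
by apply: row3P; rewrite !mxE /vol !dotE !crossE; ring.
Qed.

Lemma dot_delta i v : dot (delta_mx 0 i) v = v 0 i.
Proof.
rewrite /dot (bigD1 i) //= !mxE !eqxx mul1r big1 ?addr0 // => j ne.
by rewrite mxE (negPf ne) andbF mul0r.
Qed.

End Vec3.

(** * Ideals of ternary forms *)

Section Ideal.
Local Open Scope ring_scope.
Variable S : comNzRingType.

Record is_ideal (I : S -> Prop) : Prop := IsIdeal {
  ideal0 : I 0;
  idealD : forall p q, I p -> I q -> I (p + q);
  idealM : forall a p, I p -> I (a * p) }.

Definition adjoin (I : S -> Prop) (a : S) : S -> Prop :=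
  fun p => exists i q, I i /\ p = i + q * a.

Lemma idealN I p : is_ideal I -> I p -> I (- p).
Proof. by move=> idI Ip; rewrite -mulN1r; apply: idealM. Qed.

Lemma idealB I p q : is_ideal I -> I p -> I q -> I (p - q).
Proof. by move=> idI Ip Iq; apply: idealD => //; apply: idealN. Qed.

Lemma ideal_sum I (T : Type) (r : seq T) (P : pred T) F : is_ideal I ->
  (forall i, P i -> I (F i)) -> I (\sum_(i <- r | P i) F i).
Proof.
by move=> idI IF; apply: (big_ind I); [exact: ideal0|exact: idealD|].
Qed.

Lemma is_ideal_adjoin I a : is_ideal I -> is_ideal (adjoin I a).
Proof.
move=> idI; split.
- by exists 0, 0; split; [exact: ideal0|rewrite mul0r addr0].
- move=> _ _ [i [q [Ii ->]]] [i' [q' [Ii' ->]]].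
  by exists (i + i'), (q + q'); split; [exact: idealD|ring].
- move=> b _ [i [q [Ii ->]]].
  by exists (b * i), (b * q); split; [exact: idealM|ring].
Qed.

Lemma sub_adjoin I a p : I p -> adjoin I a p.
Proof. by move=> Ip; exists p, 0; split=> //; ring. Qed.

Lemma mem_adjoin I a : is_ideal I -> adjoin I a a.
Proof. by move=> idI; exists 0, 1; split; [exact: ideal0|ring]. Qed.

End Ideal.

Section Polynomials.
Local Open Scope ring_scope.
Variable K : numFieldType.
Local Notation S := {mpoly K[3]}.
Implicit Types (a b c v : 'rV[K]_3) (I : S -> Prop) (p q : S).

(** For an ideal this means containing a power of the ideal of the variables, that is, having no
    zero in the projective plane. *)
Definition irrelevant I := exists N : nat, forall i : 'I_3, I ('X_i ^+ N).

Lemma irrelevant_sub I I' :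
  (forall p, I p -> I' p) -> irrelevant I -> irrelevant I'.
Proof. by move=> sub [N IN]; exists N => i; apply/sub/IN. Qed.

(* This replaces the Nullstellensatz: a prime ideal containing I contains p
   or q. *)
Lemma irrelevant_mul I p q : is_ideal I -> I (p * q) ->
  irrelevant (adjoin I p) -> irrelevant (adjoin I q) -> irrelevant I.
Proof.
move=> idI Ipq [N IN] [M IM]; exists (N + M)%N => i.
have [j [r [Ij e1]]] := IN i; have [k [s [Ik e2]]] := IM i.
rewrite exprD e1 e2.
have -> : (j + r * p) * (k + s * q) =
  (k + s * q) * j + r * p * k + r * s * (p * q) by ring.
by do !apply: (idealD idI); apply: (idealM idI).
Qed.

Lemma irrelevant1 I : is_ideal I -> I 1 -> irrelevant I.
Proof. by move=> idI I1; exists 0%N => i; rewrite expr0. Qed.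

(** This plays the role of a case distinction: at a zero of [I] one of the factors vanishes. *)
Lemma irrelevant_prod (T : eqType) (s : seq T) (F : T -> S) I : is_ideal I ->
  I (\prod_(t <- s) F t) -> (forall t, t \in s -> irrelevant (adjoin I (F t))) ->
  irrelevant I.
Proof.
elim: s I => [|t s IHs] I idI; first by rewrite big_nil => I1 _; exact: irrelevant1.
rewrite big_cons => It irr; apply: (irrelevant_mul idI It).
  by apply: irr; rewrite mem_head.
apply: IHs; first exact: is_ideal_adjoin.
  exact: mem_adjoin.
move=> u us; apply: irrelevant_sub (irr u _); last by rewrite inE us orbT.
by move=> _ [i [q [Ii ->]]]; exists i, q; split=> //; apply: sub_adjoin.
Qed.

Lemma linformD a b : linform (a + b) = linform a + linform b.
Proof. by rewrite /linform !sum3 !mxE !scalerDl; ring. Qed.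

Lemma linformZ (k : K) a : linform (k *: a) = k%:MP * linform a.
Proof. by rewrite /linform !sum3 !mxE mul_mpolyC !scalerDr !scalerA. Qed.

Lemma linform_delta i : linform (delta_mx 0 i : 'rV[K]_3) = 'X_i.
Proof.
rewrite /linform (bigD1 i) //= !mxE !eqxx scale1r big1 ?addr0 // => j ne.
by rewrite mxE (negPf ne) andbF scale0r.
Qed.

Lemma linform_homog a : linform a \is 1.-homog.
Proof. by apply: rpred_sum => i _; rewrite dhomogZ // dhomogX /= mdeg1. Qed.

Lemma mul_linform_homog a p k : p \is k.-homog -> linform a * p \is k.+1.-homog.
Proof. by move=> hp; rewrite -[k.+1]add1n dhomogM ?linform_homog. Qed.

Lemma irrelevant_vol I a b c : is_ideal I -> vol a b c != 0 ->
  I (linform a) -> I (linform b) -> I (linform c) -> irrelevant I.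
Proof.
move=> idI nz Ia Ib Ic; exists 1%N => i; rewrite expr1.
have -> : 'X_i = linform ((vol a b c)^-1 *: (vol a b c *: (delta_mx 0 i : 'rV[K]_3))).
  by rewrite scalerA mulVf // scale1r linform_delta.
rewrite cramer3 linformZ !linformD !linformZ.
by apply: idealM => //; do 2?apply: idealD => //; apply: idealM.
Qed.

Definition dirder v p : S := \sum_(i < 3) v 0 i *: mderiv i p.

Lemma dirder_addl v w p : dirder (v + w) p = dirder v p + dirder w p.
Proof. by rewrite /dirder !sum3 !mxE !scalerDl; ring. Qed.

Lemma dirder_scalel (k : K) v p : dirder (k *: v) p = k%:MP * dirder v p.
Proof. by rewrite /dirder !sum3 !mxE mul_mpolyC !scalerDr !scalerA. Qed.

Lemma dirderM v p q : dirder v (p * q) = dirder v p * q + p * dirder v q.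
Proof.
rewrite /dirder mulr_suml mulr_sumr -big_split /=; apply: eq_bigr => i _.
by rewrite mderivM scalerDr scalerAl scalerAr.
Qed.

Lemma dirder1 v : dirder v 1 = 0.
Proof. by rewrite /dirder big1 // => i _; rewrite mderivC scaler0. Qed.

Lemma dirder_linform v a : dirder v (linform a) = (dot a v)%:MP.
Proof.
rewrite /dirder /dot (raddf_sum (@mpolyC 3 K)); apply: eq_bigr => i _.
rewrite /linform (raddf_sum (mderiv i)) (bigD1 i) //= big1 ?addr0 => [|j ne].
  rewrite mderivZ mderivX mnm1E eqxx scale1r -{1}(add0m U_(i)%MM) addmK mpolyX0.
  by rewrite scalerA alg_mpolyC mulrC.
by rewrite mderivZ mderivX mnm1E (negPf ne) scale0r scaler0.
Qed.

Lemma dirder_delta i p : dirder (delta_mx 0 i : 'rV[K]_3) p = mderiv i p.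
Proof.
rewrite /dirder (bigD1 i) //= !mxE !eqxx scale1r big1 ?addr0 // => j ne.
by rewrite mxE (negPf ne) andbF scale0r.
Qed.

Lemma mderiv_homog i p k : p \is k.+1.-homog -> mderiv i p \is k.-homog.
Proof.
move=> /dhomogP hp; apply/dhomogP => m; rewrite mcoeff_msupp mcoeff_mderiv => nz.
have /hp : (m + U_(i))%MM \in msupp p.
  by rewrite mcoeff_msupp; apply: contraNneq nz => ->; rewrite mul0rn.
by rewrite /= mdegD mdeg1 addn1 => -[].
Qed.

Lemma dirder_homog v p k : p \is k.+1.-homog -> dirder v p \is k.-homog.
Proof. by move=> hp; apply: rpred_sum => i _; rewrite dhomogZ // mderiv_homog. Qed.

Lemma euler p k : p \is k.-homog -> \sum_(i < 3) 'X_i * mderiv i p = k%:R * p.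
Proof.
move=> /dhomogP hp; rewrite [in RHS](mpolyE p) mulr_sumr.
under eq_bigr => i _ do rewrite {1}[p]mpolyE (raddf_sum (mderiv i)) mulr_sumr.
rewrite exchange_big /= !big_seq; apply: eq_bigr => m /hp /= <-.
rewrite mdegE natr_sum mulr_suml; apply: eq_bigr => i _.
rewrite mderivZ mderivX; have [->|nz] := posnP (m i).
  by rewrite !(scale0r, scaler0, mulr0, mul0r).
rewrite -!scalerAr -mpolyXD addmC submK; last by rewrite lep1mP -lt0n.
by rewrite scaler_nat mulr_natl -scalerMnr.
Qed.

Lemma natr_mpoly_inv k : (0 < k)%N -> (k%:R^-1)%:MP * k%:R = 1 :> S.
Proof.
move=> k0; rewrite -(rmorph_nat (@mpolyC 3 K)) /= -mpolyCM mulVf ?mpolyC1 //.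
by rewrite pnatr_eq0 -lt0n.
Qed.

Lemma homog0_const p : p \is 0.-homog -> p = (p@_0%MM)%:MP.
Proof.
move=> /dhomogP hp; apply/mpolyP => m; rewrite mcoeffC.
have [->|nz] := eqVneq m 0%MM; first by rewrite mulr1.
rewrite mulr0; apply: memN_msupp_eq0; apply: contra nz => /hp /= /eqP.
by rewrite mdeg_eq0.
Qed.

(** In the coordinates [a], [b], [c] the only monomial free of [a] and [b] is the pure power of [c].
    Euler's formula and Cramer's rule replace the change of coordinates. *)
Lemma homog_split a b c k p : vol a b c != 0 -> p \is k.+1.-homog ->
  exists q r (u : K), [/\ q \is k.-homog, r \is k.-homog &
    p = linform a * q + linform b * r + u%:MP * linform c ^+ k.+1].
Proof.
move=> nz; have splitS : forall j q, q \is j.+1.-homog -> exists q1 q2 q3,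
    [/\ q1 \is j.-homog, q2 \is j.-homog, q3 \is j.-homog &
     q = linform a * q1 + linform b * q2 + linform c * q3].
  move=> j q hq; pose e i : 'rV[K]_3 := delta_mx 0 i.
  pose w := (vol a b c)^-1; pose d i := ((j.+1%:R)^-1)%:MP * mderiv i q.
  have hd i : d i \is j.-homog.
    by rewrite /d mul_mpolyC dhomogZ // mderiv_homog.
  exists (\sum_i (w * dot (e i) (cross b c)) *: d i),
    (\sum_i (w * dot (e i) (cross c a)) *: d i),
    (\sum_i (w * dot (e i) (cross a b)) *: d i).
  split; try by apply: rpred_sum => i _; rewrite dhomogZ.
  have -> : q = \sum_i 'X_i * d i.
    under eq_bigr => i _ do rewrite mulrCA.
    by rewrite -mulr_sumr (euler hq) mulrA natr_mpoly_inv // mul1r.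
  rewrite !mulr_sumr -!big_split /=; apply: eq_bigr => i _.
  have -> : 'X_i = linform (w *: (vol a b c *: e i)).
    by rewrite scalerA mulVf // scale1r linform_delta.
  rewrite cramer3 linformZ !linformD !linformZ -!mul_mpolyC !mpolyCM; ring.
elim: k p => [|k IHk] p /splitS [q [r [t [hq hr ht ->]]]].
  exists q, r, (t@_0%MM); split=> //.
  by rewrite (homog0_const ht) mcoeffC eqxx mulr1 expr1; ring.
have [q' [r' [u [hq' hr' ->]]]] := IHk _ ht.
exists (q + linform c * q'), (r + linform c * r'), u; split.
- by rewrite dhomogD // mul_linform_homog.
- by rewrite dhomogD // mul_linform_homog.
- by rewrite (exprS _ k.+1); ring.
Qed.

End Polynomials.

(** * The Jacobian ideal *)

Section Jacobian.
Local Open Scope ring_scope.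
Variable K : numFieldType.
Local Notation S := {mpoly K[3]}.
Implicit Types (a b c v : 'rV[K]_3) (J : S -> Prop) (p q f g : S) (B : seq S).

Lemma vec_neq0P a : a != 0 -> exists u, dot a u = 1.
Proof.
move=> nz; have [i nzi] : exists i, a 0 i != 0.
  apply/existsP; apply: contraNT nz; rewrite negb_exists => /forallP z.
  by apply/eqP/rowP => i; rewrite mxE; apply/eqP; have := z i; rewrite negbK.
exists ((a 0 i)^-1 *: delta_mx 0 i).
by rewrite dotZr dotC dot_delta mulVf.
Qed.

(** Expand the double product of [u] with [cross a b], where [dot a u = 1]. *)
Lemma cross_eq0 a b : a != 0 -> cross a b = 0 -> exists k, b = k *: a.
Proof.
move=> /vec_neq0P[u au1] ab0; exists (dot u b).
have := cross_cross u a b; rewrite ab0 (dotC u a) au1 scale1r.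
have -> : cross u (0 : 'rV[K]_3) = 0 by apply: row3P; rewrite !crossE !mxE; ring.
by move/esym/eqP; rewrite subr_eq0 => /eqP.
Qed.

(** By the pigeonhole principle a monomial of degree at least [3 * N] in three variables is
    divisible by some ['X_i ^+ N]. *)
Lemma homog_irrelevant J : is_ideal J -> irrelevant J ->
  exists N : nat, forall k g, (N <= k)%N -> g \is k.-homog -> J g.
Proof.
move=> idJ [N JN]; exists (3 * N)%N => k g leNk /dhomogP hg.
rewrite (mpolyE g) big_seq; apply: ideal_sum => // m /hg /= degm.
rewrite -mul_mpolyC; apply: (idealM idJ).
have [i leNi] : exists i, (N <= m i)%N.
  apply/existsP; rewrite -[X in is_true X]negbK negb_exists.
  apply/negP => /forallP lt; have e : mdeg m = (m 0%R + m 1%R + m 2%:R%R)%N by rewrite mdegE sum3.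
  have l i : (m i < N)%N by rewrite ltnNge; exact: lt.
  move: leNk; rewrite -degm e; move: (l 0) (l 1) (l 2%:R).
  by move: (m _) (m _) (m _) => x y z; clear; lia.
have -> : m = (m - U_(i) *+ N + U_(i) *+ N)%MM.
  rewrite submK //; apply/mnm_lepP => j; rewrite mulmnE mnm1E.
  by case: eqP => [<-|_]; rewrite ?mul0n ?mul1n.
by rewrite mpolyXD; apply: (idealM idJ); rewrite -mpolyXn.
Qed.

Lemma pihomogM k e p q : q \is e.-homog ->
  pihomog mdeg (k + e) (p * q) = pihomog mdeg k p * q.
Proof.
move=> hq; rewrite {1}[p]mpolyE mulr_suml (raddf_sum (pihomog mdeg (k + e))) /=.
rewrite (pihomogE mdeg k) mulr_suml [RHS]big_mkcond /=; apply: eq_bigr => m _.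
have hX : 'X_[m] * q \is (mdeg m + e).-homog by rewrite dhomogM // dhomogX.
rewrite -scalerAl linearZ /=; case: eqP => [<-|/eqP ne].
  by rewrite pihomog_dE.
by rewrite (pihomog_ne0 _ hX) ?scaler0 // eqn_add2r.
Qed.

(** The linear span over [K], by recursion on the list of generators: only the length of the list
    matters, as a bound for a codimension. *)
Fixpoint in_span B p : Prop :=
  if B is b :: B' then exists u : K, in_span B' (p - u%:MP * b) else p = 0.

Lemma in_span_cat B B' p q : in_span B p -> in_span B' q -> in_span (B ++ B') (p + q).
Proof.
elim: B p => [|b B IHB] p /=; first by move=> ->; rewrite add0r.
by move=> [u pB] qB'; exists u; rewrite addrAC; apply: IHB.
Qed.

Lemma in_span_map B p q : in_span B p -> in_span [seq q * g | g <- B] (q * p).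
Proof.
elim: B p => [|b B IHB] p /=; first by move=> ->; rewrite mulr0.
by move=> [u /IHB pB]; exists u; congr (in_span _ _) : pB; ring.
Qed.

Definition jacobian f : S -> Prop :=
  fun p => exists c : 'I_3 -> S, p = \sum_(i < 3) c i * mderiv i f.

Lemma is_ideal_jacobian f : is_ideal (jacobian f).
Proof.
split.
- by exists (fun=> 0); rewrite big1 // => i _; rewrite mul0r.
- move=> _ _ [c ->] [c' ->]; exists (fun i => c i + c' i).
  by rewrite -big_split /=; apply: eq_bigr => i _; rewrite mulrDl.
- move=> q _ [c ->]; exists (fun i => q * c i).
  by rewrite mulr_sumr; apply: eq_bigr => i _; rewrite mulrA.
Qed.

Lemma jacobian_dirder f v : jacobian f (dirder v f).
Proof.
by exists (fun i => (v 0 i)%:MP); apply: eq_bigr => i _; rewrite mul_mpolyC.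
Qed.

Lemma jacobian_self f k : (0 < k)%N -> f \is k.-homog -> jacobian f f.
Proof.
move=> k0 /euler e; rewrite -[f in jacobian _ f]mul1r -(natr_mpoly_inv K k0) -mulrA -e.
by apply: (idealM (is_ideal_jacobian f)); exists (fun i => 'X_i).
Qed.

(** For nonzero [a] the vectors [cross a (delta_mx 0 i)] span the directions along the line [a];
    this is the ideal generated by [linform a] and the derivatives of [f] in these directions. *)
Definition tangential a f : S -> Prop := fun p =>
  exists (c : 'I_3 -> S) q,
    p = \sum_(i < 3) c i * dirder (cross a (delta_mx 0 i)) f + q * linform a.

Lemma is_ideal_tangential a f : is_ideal (tangential a f).
Proof.
split.
- by exists (fun=> 0), 0; rewrite big1 ?mul0r ?addr0 // => i _; rewrite mul0r.
- move=> _ _ [c [q ->]] [c' [q' ->]]; exists (fun i => c i + c' i), (q + q').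
  by rewrite !sum3; ring.
- move=> r _ [c [q ->]]; exists (fun i => r * c i), (r * q).
  by rewrite !sum3; ring.
Qed.

Lemma tangential_linform a f : tangential a f (linform a).
Proof. by exists (fun=> 0), 1; rewrite big1 => [|i _]; ring. Qed.

Lemma cross_delta a v : cross a v = \sum_(i < 3) v 0 i *: cross a (delta_mx 0 i).
Proof.
rewrite sum3; apply: row3P; rewrite !mxE ?add0r ?ord3_add /=; ring.
Qed.

(** If [dot a u = 1] and [v] is along [a], then [v = cross a (cross v u)]. *)
Lemma tangential_dirder a f v : a != 0 -> dot a v = 0 -> tangential a f (dirder v f).
Proof.
move=> /vec_neq0P[u au1] av0; pose w := cross v u.
have -> : v = cross a w.
  by rewrite cross_cross au1 av0 scale1r scale0r subr0.
exists (fun i => (w 0 i)%:MP), 0; rewrite mul0r addr0.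
rewrite {1}cross_delta.
by rewrite !sum3 !dirder_addl !dirder_scalel.
Qed.

(** In Euler's formula each basis vector is made tangent to [a] by subtracting a multiple of [u];
    the corrections add up to [dirder u f * linform a]. *)
Lemma tangential_self a f k : a != 0 -> (0 < k)%N -> f \is k.-homog -> tangential a f f.
Proof.
move=> a0 k0 /euler e; have [u au1] := vec_neq0P a0.
rewrite -[f in tangential _ _ f]mul1r -(natr_mpoly_inv K k0) -mulrA -e.
have idT := is_ideal_tangential a f; apply: (idealM idT).
have -> : \sum_(i < 3) 'X_i * mderiv i f =
    \sum_(i < 3) 'X_i * dirder (delta_mx 0 i - a 0 i *: u) f + dirder u f * linform a.
  rewrite /linform mulr_sumr -big_split /=; apply: eq_bigr => i _.
  rewrite -scaleNr dirder_addl dirder_scalel dirder_delta -mul_mpolyC mpolyCN; ring.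
apply: (idealD idT); last by apply: (idealM idT); exact: tangential_linform.
apply: ideal_sum => // i _; apply: (idealM idT); apply: tangential_dirder => //.
by rewrite -scaleNr dotDr dotZr au1 dotC dot_delta mulr1 subrr.
Qed.

End Jacobian.

(** * Codimension of the Jacobian ideal of a line arrangement *)

Section Codimension.
Local Open Scope ring_scope.
Variables (K : numFieldType) (I P : eqType) (av : I -> 'rV[K]_3).
Local Notation S := {mpoly K[3]}.
Implicit Types (a b c v : 'rV[K]_3) (J : S -> Prop) (p q f g : S) (B : seq S).
Implicit Types (i j h t : I) (s T : seq I).

Definition defining_form s : S := \prod_(i <- s) linform (av i).

Local Notation arr := defining_form.

Lemma arr_cons i s : arr (i :: s) = linform (av i) * arr s.
Proof. exact: big_cons. Qed.

Lemma arr_cat s T : arr (s ++ T) = arr s * arr T.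
Proof. exact: big_cat. Qed.

Lemma arr_perm s T : perm_eq s T -> arr s = arr T.
Proof. by move=> e; apply: perm_big. Qed.

Lemma arr_rem t T : uniq T -> t \in T ->
  arr T = linform (av t) * arr [seq u <- T | u != t].
Proof. by move=> uT tT; rewrite /defining_form (bigD1_seq t) //= big_filter. Qed.

Lemma arr_homog s : arr s \is (size s).-homog.
Proof.
elim: s => [|i s IHs]; first by rewrite /defining_form big_nil dhomog1.
by rewrite arr_cons mul_linform_homog.
Qed.

Lemma vol_exists a b : cross a b != 0 -> exists c, vol a b c != 0.
Proof.
by move=> /vec_neq0P[u e]; exists u; rewrite /vol e oner_eq0.
Qed.

(** On the line [a], forms modulo a product of degree [size s] have at most [size s] dimensions:
    each factor splits off one pure power by [homog_split]. The clause on [r = 0] covers degree 0,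
    where the predecessor is not the true degree of [r]. *)
Lemma span_mod_prod a s : {in s, forall i, cross a (av i) != 0} ->
  forall n, exists2 B, size B = size s & forall g, g \is (size s + n).-homog ->
  exists q r, [/\ q \is n.-homog, r \is (size s + n).-1.-homog,
    (size s + n = 0)%N -> r = 0 & in_span B (g - arr s * q - linform a * r)].
Proof.
elim: s => [|y s IHs] nz n.
  exists [::] => // g hg; exists g, 0; split=> //=; first exact: dhomog0.
  by rewrite /defining_form big_nil; ring.
have [|B sB spB] := IHs _ n; first by move=> i si; rewrite nz // inE si orbT.
have [|w volw] := @vol_exists (av y) a.
  by rewrite crossC oppr_eq0 nz ?mem_head.
exists (linform w ^+ (size s + n).+1 :: [seq linform (av y) * g | g <- B]).
  by rewrite /= size_map sB.
move=> g hg; have [|g1 [r1 [u [hg1 hr1 ->]]]] := homog_split (p := g) (k := size s + n) volw.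
  exact: hg.
have [q [r [hq hr r0 sp]]] := spB _ hg1.
exists q, (r1 + linform (av y) * r); split=> //.
- rewrite addSn /= dhomogD //; case: (posnP (size s + n)) => [z|pos].
    by rewrite r0 // mulr0 dhomog0.
  by rewrite -(prednK pos) mul_linform_homog.
- exists u; move/in_span_map: sp => /(_ (linform (av y))).
  by congr (in_span _ _); rewrite arr_cons; ring.
Qed.

(** The combination of [b] and [c] vanishes at [v] and at a common point of the three lines, as [a]
    does. Cramer's identity paired with [v] shows that its cross product with [a] is zero. *)
Lemma tangent_proportional a b c v : a != 0 -> vol a b c = 0 -> dot a v = 0 ->
  exists k : K, (dot c v)%:MP * linform b - (dot b v)%:MP * linform c = k%:MP * linform a.
Proof.
move=> a0 vol0 av0; have [k e] : exists k, dot c v *: b - dot b v *: c = k *: a.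
  apply: (cross_eq0 a0).
  have cr x : dot x (cross a (dot c v *: b - dot b v *: c)) = 0.
    have := congr1 (dot v) (cramer3 a b c x).
    rewrite vol0 scale0r dot0r !dotDr !dotZr (dotC v a) av0 mulr0 add0r => e.
    by rewrite [RHS]e !dotE !crossE !mxE; ring.
  by apply/rowP => i; rewrite -dot_delta cr mxE.
exists k; rewrite -linformZ -e linformD -scaleNr !linformZ mpolyCN; ring.
Qed.

End Codimension.

Lemma uniq_map_injective (T1 T2 : eqType) (f : T1 -> T2) (s : seq T1) :
  uniq (map f s) -> {in s &, injective f}.
Proof.
elim: s => //= x s IHs /andP[nx us] y z; rewrite !inE.
move=> /predU1P[->|ys] /predU1P[->|zs] // e; last exact: IHs.
  by rewrite e map_f in nx.
by rewrite -e map_f in nx.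
Qed.

(** * Derivatives of the arrangement along a line *)

Section Restriction.
Local Open Scope ring_scope.
Variables (K : numFieldType) (I P : eqType) (av : I -> 'rV[K]_3).
Local Notation S := {mpoly K[3]}.
Local Notation arr := (defining_form av).
Variables (a : 'rV[K]_3) (pt : I -> P) (s0 : seq I).
Hypothesis a0 : a != 0.
Hypothesis ptE : {in s0 &, forall i j, (pt i == pt j) = (vol a (av i) (av j) == 0)}.
Implicit Types (v : 'rV[K]_3) (p q f g : S) (B : seq S).
Implicit Types (i j h t : I) (s T : seq I).

(* Modulo the line a, the arrangement s is a product of powers of the
   representatives T of the points of s on a, and G is the product with all
   exponents lowered by one. *)
Lemma tangent_derivative s : {subset s <= s0} -> exists T G (mu : I -> nat),
  [/\ perm_eq s (G ++ T), uniq (map pt T), map pt T =i map pt s,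
    {in T, forall t, 0 < mu t}%N &
    forall v, dot a v = 0 -> exists q, dirder v (arr s) =
      arr G * \sum_(t <- T) (mu t)%:R * (dot (av t) v)%:MP *
                 arr [seq u <- T | u != t] + q * linform a].
Proof.
elim: s => [|b s IHs] sub.
  exists [::], [::], (fun=> 0%N); split=> // v _; exists 0.
  by rewrite big_nil /defining_form big_nil dirder1; ring.
have sub' : {subset s <= s0} by move=> i si; apply: sub; rewrite inE si orbT.
have s0b : b \in s0 by apply: sub; rewrite mem_head.
have [T [G [mu [sGT uT mT mu0 D]]]] := IHs sub'.
have uT' := map_uniq uT.
have subT : {subset T <= s0}.
  by move=> t tT; apply: sub'; rewrite (perm_mem sGT) mem_cat tT orbT.
have arrs : arr s = arr G * arr T by rewrite (arr_perm av sGT) arr_cat.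
case: (boolP (pt b \in map pt T)) => [/mapP[t tT ebt]|bNT].
- exists T, (b :: G), (fun i => if i == t then (mu i).+1 else mu i).
  split=> //.
  + by rewrite /= perm_cons.
  + by move=> x; rewrite mT inE; case: eqP => // ->; rewrite -mT ebt map_f.
  + by move=> i iT; case: eqP => // _; apply: mu0.
  move=> v av0; have [q Dq] := D v av0.
  have /eqP vol0 : vol a (av b) (av t) == 0 by rewrite -(ptE s0b (subT _ tT)) ebt.
  (* Modulo [a], the derivative of [b] times [t] equals the derivative of [t] times [b], so [b] acts
     as one more copy of [t]. *)
  have [k ek] := tangent_proportional a0 vol0 av0.
  pose Q := arr [seq u <- T | u != t].
  have sumE : \sum_(i <- T) (if i == t then (mu i).+1 else mu i)%:R *
      (dot (av i) v)%:MP * arr [seq u <- T | u != i] =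
      \sum_(i <- T) (mu i)%:R * (dot (av i) v)%:MP * arr [seq u <- T | u != i]
      + (dot (av t) v)%:MP * Q.
    rewrite !(bigD1_seq t) //= eqxx -[(mu t).+1]addn1 natrD.
    under eq_bigr => i ne do rewrite (negPf ne).
    by rewrite /Q; ring.
  exists (q * linform (av b) - k%:MP * arr G * Q).
  rewrite sumE !arr_cons dirderM dirder_linform Dq arrs (arr_rem av uT' tT) -/Q.
  set X := \sum_(_ <- _) _.
  have -> : (q * linform (av b) - k%:MP * arr G * Q) * linform a =
    q * linform (av b) * linform a - arr G * Q * (k%:MP * linform a) by ring.
  by rewrite -ek; ring.
- have neb t : t \in T -> (t == b) = false.
    by move=> tT; apply: contraNF bNT => /eqP <-; apply: map_f.
  exists (b :: T), G, (fun i => if i == b then 1%N else mu i); split.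
  + by rewrite perm_sym -[b :: T]cat1s perm_catCA perm_cons perm_sym.
  + by rewrite /= bNT.
  + by move=> x; rewrite !inE mT.
  + by move=> i; rewrite inE; case: eqP => //= _; apply: mu0.
  move=> v av0; have [q Dq] := D v av0.
  exists (q * linform (av b)).
  rewrite big_cons !arr_cons dirderM dirder_linform Dq arrs eqxx /= eqxx /=.
  have -> : [seq u <- T | u != b] = T.
    by apply/all_filterP/allP => t tT; rewrite (neb _ tT).
  have -> : \sum_(j <- T) (if j == b then 1%N else mu j)%:R * (dot (av j) v)%:MP *
      arr (if b != j then b :: [seq u <- T | u != j] else [seq u <- T | u != j]) =
    linform (av b) * \sum_(j <- T) (mu j)%:R * (dot (av j) v)%:MP *
      arr [seq u <- T | u != j].
    rewrite mulr_sumr !big_seq; apply: eq_bigr => j jT.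
    by rewrite neb // eq_sym neb //= arr_cons; ring.
  set X := \sum_(_ <- _) _; ring.
Qed.

(** The colon ideal of the tangential ideal by [arr G] contains [arr T], so a zero of it lies on [a]
    and some [t] of [T]. There a tangential derivative leaves only the term of [t], whose
    coefficient is nonzero as [mu t] is positive; hence another [u] of [T] vanishes, although [a],
    [t], [u] are not concurrent. *)
Lemma tangential_irrelevant s T G (mu : I -> nat) :
  {in s0, forall i, cross a (av i) != 0} -> {subset s <= s0} -> s != [::] ->
  perm_eq s (G ++ T) -> uniq (map pt T) -> {in T, forall t, 0 < mu t}%N ->
  (forall v, dot a v = 0 -> exists q, dirder v (arr s) =
      arr G * \sum_(t <- T) (mu t)%:R * (dot (av t) v)%:MP *
                 arr [seq u <- T | u != t] + q * linform a) ->
  irrelevant (fun p => tangential a (arr s) (arr G * p)).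
Proof.
move=> nz sub sn0 sGT uT mu0 D; have uT' := map_uniq uT.
have subT : {subset T <= s0}.
  by move=> t tT; apply: sub; rewrite (perm_mem sGT) mem_cat tT orbT.
have idT := is_ideal_tangential a (arr s).
set J := fun p => _; have idJ : is_ideal J.
  split=> [|p q Jp Jq|p q Jq]; rewrite /J.
  - by rewrite mulr0; exact: ideal0.
  - by rewrite mulrDr; apply: (idealD idT).
  - by rewrite mulrCA; apply: (idealM idT).
have Ja : J (linform a) by apply: (idealM idT); exact: tangential_linform.
apply: (irrelevant_prod (s := T) (F := fun t => linform (av t)) idJ).
  rewrite /J -[X in _ * X]/(arr T) -arr_cat -(arr_perm av sGT).
  by apply: (tangential_self a0 _ (arr_homog av s)); rewrite lt0n size_eq0.
move=> t tT; have idJt := is_ideal_adjoin (linform (av t)) idJ.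
have [v [av0 tv0]] : exists v, dot a v = 0 /\ dot (av t) v != 0.
  have [u e] := vec_neq0P (nz _ (subT _ tT)).
  exists (cross u a); split; first exact: dot_crossr.
  by rewrite dotC -/(vol u a (av t)) vol_rot /vol e oner_eq0.
have JQ : adjoin J (linform (av t)) (arr [seq u <- T | u != t]).
  have [q Dq] := D v av0.
  pose X := \sum_(i <- T) (mu i)%:R * (dot (av i) v)%:MP * arr [seq u <- T | u != i].
  have JX : J X.
    rewrite /J (_ : arr G * X = dirder v (arr s) - q * linform a); last first.
      by rewrite Dq -/X; ring.
    apply: (idealB idT); first exact: tangential_dirder.
    by apply: (idealM idT); exact: tangential_linform.
  have [R XE] : exists R, X = (mu t)%:R * (dot (av t) v)%:MP *
      arr [seq u <- T | u != t] + R * linform (av t).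
    pose R i := (mu i)%:R * (dot (av i) v)%:MP *
       arr [seq u <- [seq u <- T | u != i] | u != t].
    exists (\sum_(i <- T | i != t) R i); rewrite /X (bigD1_seq t) //=; congr (_ + _).
    rewrite mulr_suml; apply: eq_bigr => i ne.
    rewrite (@arr_rem _ _ av t) ?filter_uniq ?mem_filter ?tT ?(eq_sym t) ?ne //.
    by rewrite /R; ring.
  have -> : arr [seq u <- T | u != t] =
      ((dot (av t) v)^-1)%:MP * (((mu t)%:R^-1)%:MP * (X - R * linform (av t))).
    rewrite XE addrK -mulrA [((mu t)%:R^-1)%:MP * _]mulrA natr_mpoly_inv ?mu0 //.
    by rewrite mul1r mulrA -mpolyCM mulVf // mpolyC1 mul1r.
  do 2!apply: (idealM idJt); apply: (idealB idJt); first exact: sub_adjoin.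
  by apply: (idealM idJt); exact: mem_adjoin.
apply: (irrelevant_prod (s := [seq u <- T | u != t])
  (F := fun t => linform (av t)) idJt JQ).
move=> u; rewrite mem_filter => /andP[ne uTu].
have idJu := is_ideal_adjoin (linform (av u)) idJt.
apply: (irrelevant_vol (a := a) (b := av t) (c := av u) idJu).
- rewrite -(ptE (subT _ tT) (subT _ uTu)); apply: contra ne => /eqP e.
  by rewrite (uniq_map_injective uT tT uTu e).
- by do 2!apply: sub_adjoin.
- by apply: sub_adjoin; exact: mem_adjoin.
- exact: mem_adjoin.
Qed.

End Restriction.

(* The points of the arrangement counted with weight (multiplicity - 1):
   adding the line i to s adds one for each point of i on a line of s. *)
Fixpoint betti (I P : eqType) (pt : I -> I -> P) (s : seq I) : nat :=
  if s is i :: s' then betti pt s' + size (undup [seq pt i j | j <- s']) else 0.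

Lemma betti_cons (I P : eqType) (pt : I -> I -> P) (i : I) (s : seq I) :
  betti pt (i :: s) = (betti pt s + size (undup [seq pt i j | j <- s]))%N.
Proof. by []. Qed.

(** * Adding one line to the arrangement *)

Section Codim.
Local Open Scope ring_scope.
Variables (K : numFieldType) (I P : eqType) (av : I -> 'rV[K]_3).
Local Notation S := {mpoly K[3]}.
Local Notation arr := (defining_form av).
Implicit Types (a v : 'rV[K]_3) (p q f g : S) (B : seq S).
Implicit Types (i j h t : I) (s T : seq I).

(** In large degrees every multiple of [arr G] is in the tangential ideal by
    [tangential_irrelevant]. So only the forms modulo [a] and [arr G] remain, and [G] has as many
    elements as [s] minus the number of points of [s] on [a]. *)
Lemma tangent_span a (pt : I -> P) s : a != 0 -> s != [::] ->
  {in s, forall i, cross a (av i) != 0} ->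
  {in s &, forall i j, (pt i == pt j) = (vol a (av i) (av j) == 0)} ->
  exists k0 : nat, forall k, (k0 <= k)%N ->
  exists2 B, size B = (size s - size (undup (map pt s)))%N &
  forall g, g \is k.-homog -> exists (c : 'I_3 -> S) q, q \is k.-1.-homog /\
    in_span B (g - \sum_(i < 3) c i * dirder (cross a (delta_mx 0 i)) (arr s)
                 - linform a * q).
Proof.
move=> a0 sn0 nz ptE.
have [T [G [mu [sGT uT mT mu0 D]]]] := tangent_derivative a0 ptE (fun=> id).
have := tangential_irrelevant a0 ptE nz (fun=> id) sn0 sGT uT mu0 D.
set J := fun p => _ => irrJ; have idT := is_ideal_tangential a (arr s).
have idJ : is_ideal J.
  split=> [|p q Jp Jq|p q Jq]; rewrite /J.
  - by rewrite mulr0; exact: ideal0.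
  - by rewrite mulrDr; apply: (idealD idT).
  - by rewrite mulrCA; apply: (idealM idT).
have [N JN] := homog_irrelevant idJ irrJ.
have sizes : size s = (size G + size T)%N by rewrite (perm_size sGT) size_cat.
have sT : size T = size (undup (map pt s)).
  rewrite -(size_map pt T); apply: perm_size; apply: uniq_perm => //.
    exact: undup_uniq.
  by move=> x; rewrite mem_undup mT.
have s_gt0 : (0 < size s)%N by rewrite lt0n size_eq0.
exists (size s + N)%N => k lek.
have [|B sB spB] := @span_mod_prod _ _ av a G _ (k - size G)%N.
  by move=> i iG; apply: nz; rewrite (perm_mem sGT) mem_cat iG.
have kE : (size G + (k - size G) = k)%N by lia.
exists B; first by rewrite sB -sT; lia.
rewrite kE in spB; move=> g /spB[q [r [hq hr _ sp]]].
have [|c [b e]] := JN (k - size G)%N q _ hq; first by lia.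
(* Passing to homogeneous components makes the coefficient of [a] homogeneous, so that it can be
   reduced further. *)
exists (fun i : 'I_3 => pihomog mdeg (k - (size s).-1) (c i)), (r + pihomog mdeg k.-1 b).
split; first by rewrite dhomogD // pihomogP.
congr (in_span _ _) : sp.
have -> : arr G * q = pihomog mdeg k (arr G * q).
  by rewrite pihomog_dE // -{1}kE dhomogM // arr_homog.
rewrite e (raddfD (pihomog mdeg k)) (raddf_sum (pihomog mdeg k)) /=.
have k_gt0 : (0 < k)%N by lia.
have -> : pihomog mdeg k (b * linform a) = pihomog mdeg k.-1 b * linform a.
  by rewrite -(pihomogM _ _ (linform_homog a)) addn1 prednK.
have -> : \sum_(i < 3) pihomog mdeg k (c i * dirder (cross a (delta_mx 0 i)) (arr s)) =
  \sum_(i < 3) pihomog mdeg (k - (size s).-1) (c i) * dirder (cross a (delta_mx 0 i)) (arr s).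
  apply: eq_bigr => i _; rewrite -(@pihomogM _ _ (size s).-1); last first.
    by apply: dirder_homog; rewrite prednK // arr_homog.
  by rewrite subnK //; lia.
by ring.
Qed.

(** With [a] the new form and [f] the old product, the product rule gives
    [a ^ 2 * f' = a * (a * f)' - a' * (a * f)], and [a * f] is in its own Jacobian ideal by Euler's
    formula. *)
Lemma jacobian_cons h s p : jacobian (arr s) p ->
  jacobian (arr (h :: s)) (linform (av h) ^+ 2 * p).
Proof.
move=> [c ->]; have idJ := is_ideal_jacobian (arr (h :: s)).
rewrite mulr_sumr; apply: ideal_sum => // i _; rewrite mulrCA; apply: (idealM idJ).
have -> : linform (av h) ^+ 2 * mderiv i (arr s) =
    linform (av h) * dirder (delta_mx 0 i) (arr (h :: s))
    - (dot (av h) (delta_mx 0 i))%:MP * arr (h :: s).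
  by rewrite arr_cons dirderM dirder_linform dirder_delta; ring.
apply: (idealB idJ); apply: (idealM idJ); first exact: jacobian_dirder.
exact: (jacobian_self _ (arr_homog av (h :: s))).
Qed.

(* Let a be the line h and F the form of s.  Modulo the Jacobian ideal of a F,
   forms reduce to multiples of a up to size s dimensions, since F is in it
   modulo a; multiples of a reduce to multiples of a ^ 2 up to as many
   dimensions as [tangent_span] says, since a D_v F = D_v (a F) for v along a;
   and a ^ 2 times the Jacobian ideal of F is contained in that of a F. *)
Lemma codim_jacobian (pt : I -> I -> P) s : s != [::] -> uniq s ->
  {in s, forall i, av i != 0} ->
  {in s &, forall i j, i != j -> cross (av i) (av j) != 0} ->
  {in s & &, forall h i j, i != h -> j != h ->
     (pt h i == pt h j) = (vol (av h) (av i) (av j) == 0)} ->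
  exists k0 : nat, forall k, (k0 <= k)%N ->
  exists2 B, (size B + betti pt s <= size s * (size s).-1)%N &
  forall g, g \is k.-homog -> exists2 p, in_span B p & jacobian (arr s) (g - p).
Proof.
elim: s => // h s IHs _ /= /andP[hs us] nz0 nz ptE.
have [u au1] := vec_neq0P (nz0 h (mem_head h s)).
have idJ := is_ideal_jacobian (arr (h :: s)).
have [->|sn0] := eqVneq s [::].
  exists 0%N => k _; exists [::] => // g _; exists 0 => //.
  rewrite subr0 -(mulr1 g); apply: (idealM (is_ideal_jacobian _)).
  have <- : dirder u (arr [:: h]) = 1.
    by rewrite arr_cons /defining_form big_nil mulr1 dirder_linform au1 mpolyC1.
  exact: jacobian_dirder.
have a0 : av h != 0 by apply: nz0; rewrite mem_head.
have neh i : i \in s -> i != h by move=> si; apply: contraNneq hs => <-.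
have nzh : {in s, forall i, cross (av h) (av i) != 0}.
  by move=> i si; rewrite nz ?mem_head ?inE ?si ?orbT // eq_sym neh.
have ss i : i \in s -> i \in h :: s by move=> si; rewrite inE si orbT.
have s_gt0 : (0 < size s)%N by rewrite lt0n size_eq0.
have [|||k1 IH] := IHs sn0 us.
- by move=> i si; apply: nz0; exact: ss.
- by move=> i j si sj; apply: nz; exact: ss.
- by move=> i j l si sj sl; apply: ptE; exact: ss.
have [|k2 H2] := @tangent_span _ (pt h) _ a0 sn0 nzh.
  by move=> i j si sj; apply: ptE; rewrite ?mem_head ?ss ?neh.
exists (k1 + k2 + size s + 2)%N => k lek.
have [|B3 sB3 sp3] := IH k.-2; first by lia.
have [|B2 sB2 sp2] := H2 k.-1; first by lia.
have [B1 sB1] := span_mod_prod nzh (k - size s)%N.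
have kE : (size s + (k - size s) = k)%N by lia.
rewrite kE => sp1; set a := linform (av h).
(* With [n = size s], [r] points on [h] and [b = betti pt s], the sizes add up to at most [n + (n -
   r) + (n * (n - 1) - b) = (n + 1) * n - (b + r)]. *)
exists (B1 ++ [seq a * g | g <- B2 ++ [seq a * g | g <- B3]]).
  rewrite /= size_cat size_map size_cat size_map sB1 sB2.
  have : (size (undup (map (pt h) s)) <= size s)%N.
    by rewrite -[X in (_ <= X)%N](size_map (pt h)) size_undup.
  move: sB3 s_gt0; move: (size (undup _)) (size B3) (betti _ _) (size s).
  by clear=> r b3 b [|n] //=; nia.
move=> g /sp1[q [r [hq hr _ in1]]].
(* Since [dirder u (a * F) = F + a * dirder u F], removing [F * q] through the Jacobian ideal costs
   this correction to the coefficient of [a]. *)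
pose h1 := r - dirder u (arr s) * q.
have hh1 : h1 \is k.-1.-homog.
  rewrite /h1 rpredB // (_ : k.-1 = (size s).-1 + (k - size s))%N; last by lia.
  by rewrite dhomogM // dirder_homog // prednK // arr_homog.
have [c [h2 [hh2 in2]]] := sp2 _ hh1.
have [p3 in3 J3] := sp3 _ hh2.
have in2' := in_span_cat in2 (in_span_map a in3).
exists (g - arr s * q - a * r +
   a * (h1 - \sum_(i < 3) c i * dirder (cross (av h) (delta_mx 0 i)) (arr s)
        - a * h2 + a * p3)).
  exact: (in_span_cat in1 (in_span_map a in2')).
have -> : g - (g - arr s * q - a * r + a * (h1 - \sum_(i < 3) c i *
    dirder (cross (av h) (delta_mx 0 i)) (arr s) - a * h2 + a * p3)) =
  q * dirder u (arr (h :: s)) +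
  \sum_(i < 3) c i * dirder (cross (av h) (delta_mx 0 i)) (arr (h :: s)) +
  a ^+ 2 * (h2 - p3).
  rewrite !sum3 arr_cons !dirderM !dirder_linform !dot_crossl au1 mpolyC1 mpolyC0.
  by rewrite /h1 -/a; ring.
apply: (idealD idJ); last exact: jacobian_cons.
apply: (idealD idJ); first by apply: (idealM idJ); exact: jacobian_dirder.
by apply: ideal_sum => // i _; apply: (idealM idJ); exact: jacobian_dirder.
Qed.

End Codim.

(** * Saturated Jacobian ideals *)

Section Freeness.
Local Open Scope ring_scope.
Variables (K : numFieldType) (I P : eqType) (av : I -> 'rV[K]_3).
Local Notation S := {mpoly K[3]}.
Local Notation arr := (defining_form av).
Implicit Types (a v w : 'rV[K]_3) (p q f g : S) (B : seq S) (J : S -> Prop).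
Implicit Types (i j h t : I) (s T : seq I).

Lemma poly_nonroot (p : {poly K}) : p != 0 -> exists n : nat, p.[n%:R] != 0.
Proof.
move=> p0; have [/allP al|/allPn] := boolP (all (root p) [seq n%:R | n <- iota 0 (size p)]).
  have := max_poly_roots p0 (introT allP al).
  rewrite map_inj_uniq ?iota_uniq => [/(_ isT)|m n /eqP]; last first.
    by rewrite eqr_nat => /eqP.
  by rewrite size_map size_iota ltnn.
by move=> [_ /mapP[n _ ->]]; exists n.
Qed.

(** On the curve of vectors [(1, n, n ^ 2)] each [dot v w] is the value at [n] of a nonzero
    polynomial. *)
Lemma generic_vector (l : seq 'rV[K]_3) : all (fun v => v != 0) l ->
  exists w, {in l, forall v, dot v w != 0}.
Proof.
move=> nz; pose p v : {poly K} := Poly [:: v 0 0; v 0 1; v 0 2%:R].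
have [|n hn] := @poly_nonroot (\prod_(v <- l) p v).
  rewrite prodf_seq_neq0; apply/allP => v /(allP nz) /=.
  apply: contra_neq => pv0; apply: row3P; rewrite mxE.
  - by have := congr1 (fun q : {poly K} => q`_0) pv0; rewrite coef_Poly coef0.
  - by have := congr1 (fun q : {poly K} => q`_1) pv0; rewrite coef_Poly coef0.
  - by have := congr1 (fun q : {poly K} => q`_2) pv0; rewrite coef_Poly coef0.
exists (\row_(i < 3) n%:R ^+ i) => v lv.
move: hn; rewrite horner_prod prodf_seq_neq0 => /allP/(_ v lv) /=.
rewrite horner_Poly /= dotE !mxE /=; apply: contra_neq => e.
by rewrite -[RHS]e !modn_small // expr0 expr1 expr2; ring.
Qed.

(** At a zero of the Jacobian ideal some line [i] vanishes; the derivative across [i] then equals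
    the product of the other lines, so a second line [j] vanishes. The point is an intersection
    point, which [c] avoids. *)
Lemma generic_irrelevant s c : s != [::] -> uniq s ->
  {in s, forall i, av i != 0} ->
  {in s &, forall i j, i != j -> vol (av i) (av j) c != 0} ->
  irrelevant (adjoin (jacobian (arr s)) (linform c)).
Proof.
move=> sn0 us nz nzv; have idJ := is_ideal_jacobian (arr s).
have idJc := is_ideal_adjoin (linform c) idJ.
apply: (irrelevant_prod (s := s) (F := fun t => linform (av t)) idJc).
  apply: sub_adjoin; apply: (jacobian_self _ (arr_homog av s)).
  by rewrite lt0n size_eq0.
move=> i si; have idJi := is_ideal_adjoin (linform (av i)) idJc.
have [u au1] := vec_neq0P (nz _ si).
have JQ : adjoin (adjoin (jacobian (arr s)) (linform c)) (linform (av i))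
    (arr [seq j <- s | j != i]).
  have -> : arr [seq j <- s | j != i] = dirder u (arr s) -
      dirder u (arr [seq j <- s | j != i]) * linform (av i).
    by rewrite [in X in X - _](arr_rem av us si) dirderM dirder_linform au1 mpolyC1; ring.
  apply: (idealB idJi); last by apply: (idealM idJi); exact: mem_adjoin.
  by do 2!apply: sub_adjoin; exact: jacobian_dirder.
apply: (irrelevant_prod (F := fun t => linform (av t)) idJi JQ).
move=> j; rewrite mem_filter => /andP[ne sj].
have idJj := is_ideal_adjoin (linform (av j)) idJi.
apply: (irrelevant_vol (a := av j) (b := av i) (c := c) idJj); first exact: nzv.
- exact: mem_adjoin.
- by apply: sub_adjoin; exact: mem_adjoin.
- by do 2!apply: sub_adjoin; exact: mem_adjoin.
Qed.

Lemma jacobian_idealP f p : jacobian_ideal f p <-> jacobian f p.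
Proof.
split=> [[s sG ->]|[c ->]].
  rewrite big_seq; apply: ideal_sum (is_ideal_jacobian f) _ => u /sG /= [i ->].
  apply: (idealM (is_ideal_jacobian f)); rewrite -dirder_delta.
  exact: jacobian_dirder.
exists [seq (c l, mderiv l f) | l <- enum 'I_3].
  by move=> u /mapP[i _ ->]; exists i.
by rewrite big_map big_enum.
Qed.

(** Membership in the [N]-th power of the ideal of the variables, read off the monomials. *)
Definition order_ge (N : nat) p := {in msupp p, forall m, (N <= mdeg m)%N}.

Lemma is_ideal_order_ge N : is_ideal (order_ge N).
Proof.
split=> [m|p q hp hq m /msuppD_le|p q hq m /msuppM_le].
- by rewrite msupp0.
- by rewrite mem_cat => /orP[/hp|/hq].
- move=> /allpairsP[[m1 m2] /= [_ /hq le ->]]; rewrite mdegD.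
  exact: leq_trans (leq_addl _ _).
Qed.

Lemma order_geM M N p q : order_ge M p -> order_ge N q -> order_ge (M + N) (p * q).
Proof.
move=> hp hq m /msuppM_le /allpairsP[[m1 m2] /= [/hp le1 /hq le2 ->]].
by rewrite mdegD leq_add.
Qed.

Lemma ideal_pow_order N p : ideal_pow (@irrelevant_ideal K) N p -> order_ge N p.
Proof.
elim: N p => [|N IHN] p /=; first by move=> _ m.
move=> [s sG ->]; rewrite big_seq; apply: ideal_sum (is_ideal_order_ge _) _.
move=> u /sG [a [b [[r rG ->] /IHN hb ->]]].
apply: (idealM (is_ideal_order_ge _)); rewrite -add1n; apply: order_geM hb.
rewrite big_seq; apply: ideal_sum (is_ideal_order_ge _) _ => v /rG [i ->].
apply: (idealM (is_ideal_order_ge _)) => m.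
by rewrite msuppX inE => /eqP ->; rewrite mdeg1.
Qed.

(** A high power of the ideal of the variables lies in the Jacobian ideal plus the multiples of
    [linform c], hence carries [g] into the Jacobian ideal; saturation then puts [g] there. *)
Lemma saturated_regular f g c : free_curve f ->
  irrelevant (adjoin (jacobian f) (linform c)) ->
  jacobian f (linform c * g) -> jacobian f g.
Proof.
move=> sat irr fcg; have idJ := is_ideal_jacobian f.
have idJc := is_ideal_adjoin (linform c) idJ.
suff : saturation (jacobian_ideal f) (@irrelevant_ideal K) g.
  by rewrite sat => /jacobian_idealP.
have [N JN] := homog_irrelevant idJc irr; exists N => h /ideal_pow_order hN.
apply/jacobian_idealP; have [j [q [Jj ->]]] : adjoin (jacobian f) (linform c) h.
  rewrite (mpolyE h) big_seq; apply: ideal_sum => // m mh.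
  rewrite -mul_mpolyC; apply: (idealM idJc); apply: (JN (mdeg m)); first exact: hN.
  by rewrite dhomogX.
have -> : (j + q * linform c) * g = g * j + q * (linform c * g) by ring.
by apply: (idealD idJ); apply: (idealM idJ).
Qed.

Definition monomials (k : nat) : seq 'X_{1..3} :=
  [seq s2m t | t : k.-tuple 'I_3 <- enum (basis 3 k)].

Lemma size_monomials k : size (monomials k) = 'C(k + 2, 2).
Proof. by rewrite size_basis -[in RHS]bin_sub ?leq_addl // addnK. Qed.

Lemma homog_monomials k p : p \is k.-homog ->
  p = \sum_(r < size (monomials k))
        p@_(nth 0%MM (monomials k) r) *: 'X_[nth 0%MM (monomials k) r].
Proof.
move=> hp; rewrite -(big_mkord xpredT (fun r => p@_(nth 0%MM (monomials k) r) *: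
  'X_[nth 0%MM (monomials k) r])) -(big_nth 0%MM xpredT (fun m => p@_m *: 'X_[m])).
apply/mpolyP => m; rewrite (raddf_sum (mcoeff m)) /=.
have [km|nkm] := boolP (m \in monomials k).
  rewrite (bigD1_seq m) ?uniq_basis //= mcoeffZ mcoeffX eqxx mulr1 big1 ?addr0 //.
  by move=> m' ne; rewrite mcoeffZ mcoeffX (negPf ne) mulr0.
rewrite big_seq big1 => [|m' km'].
  by apply: (dhomog_nemf_coeff hp); rewrite basis_cover.
rewrite mcoeffZ mcoeffX; case: eqP => [e|_]; last by rewrite mulr0.
by rewrite -e km' in nkm.
Qed.

Lemma in_spanP B p : in_span B p ->
  exists u : 'rV[K]_(size B), p = \sum_(l < size B) u 0 l *: B`_l.
Proof.
elim: B p => [|b B IHB] p /=; first by move=> ->; exists 0; rewrite big_ord0.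
move=> [u /IHB[x e]]; exists (\row_l if unlift ord0 l is Some l' then x 0 l' else u).
rewrite big_ord_recl /= mxE unlift_none -mul_mpolyC.
under eq_bigr => l _ do rewrite mxE liftK.
by rewrite -e addrC subrK.
Qed.

Lemma coef_X_monomials k (x : 'rV[K]_(size (monomials k))) (l : 'I_(size (monomials k))) :
  (\sum_r x 0 r *: 'X_[nth 0%MM (monomials k) r])@_(nth 0%MM (monomials k) l) = x 0 l.
Proof.
rewrite (raddf_sum (mcoeff _)) (bigD1 l) //= mcoeffZ mcoeffX eqxx mulr1.
rewrite big1 ?addr0 // => r ne; rewrite mcoeffZ mcoeffX nth_uniq ?uniq_basis //.
by rewrite (inj_eq val_inj) (negPf ne) mulr0.
Qed.

(* The lower bound on the codimension of the Jacobian ideal comes from its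
   degree e + D, where there are three generators of degree D and no need to
   know their syzygies. *)
Lemma free_codim f D e c k0 tau : f \is D.+1.-homog ->
  (forall g, jacobian f (linform c * g) -> jacobian f g) ->
  (forall k, (k0 <= k)%N -> exists2 B, (size B <= tau)%N &
    forall g, g \is k.-homog -> exists2 p, in_span B p & jacobian f (g - p)) ->
  ('C(D + e + 2, 2) <= 3 * 'C(e + 2, 2) + tau)%N.
Proof.
move=> hf reg codim; have idJ := is_ideal_jacobian f.
have regX n g : jacobian f (linform c ^+ n * g) -> jacobian f g.
  by elim: n g => [|n IHn] g; rewrite ?expr0 ?mul1r // exprS -mulrA => /reg/IHn.
set k := (D + e)%N; have [|B sB sp] := codim (k0 + k)%N; first exact: leq_addr.
pose X r : S := 'X_[nth 0%MM (monomials k) r].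
have hX (r : 'I_(size (monomials k))) : X r \is k.-homog.
  by rewrite /X dhomogX basis_cover mem_nth.
have hLX (r : 'I_(size (monomials k))) : linform c ^+ k0 * X r \is (k0 + k).-homog.
  by rewrite dhomogM //; have := dhomogMn k0 (linform_homog c); rewrite mul1n.
have ex (r : 'I_(size (monomials k))) : exists x : 'rV[K]_(size B),
    jacobian f (linform c ^+ k0 * X r - \sum_(l < size B) x 0 l *: B`_l).
  by have [p /in_spanP[x ->] Jp] := sp _ (hLX r); exists x.
have [M HM] := fin_all_exists ex.
pose A := \matrix_(r, l) M r 0 l.
pose Y r : S := 'X_[nth 0%MM (monomials e) r].
pose N (i : 'I_3) := \matrix_(r < size (monomials e), l < size (monomials k))
   (Y r * mderiv i f)@_(nth 0%MM (monomials k) l).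
(* The kernel of [A] consists of forms of degree [k] in the Jacobian ideal, hence of combinations of
   the three derivatives with coefficients of degree [e]. *)
have sub : (kermx A <= N 0 + N 1%R + N 2%:R)%MS.
  apply/row_subP => i; set x := row i _.
  have xA : x *m A = 0 by rewrite -row_mul mulmx_ker row0.
  pose g := \sum_r x 0 r *: X r.
  have [d gE] : jacobian f g.
    apply: (regX k0); rewrite mulr_sumr.
    have -> : \sum_r linform c ^+ k0 * (x 0 r *: X r) = \sum_r (x 0 r)%:MP *
        (linform c ^+ k0 * X r - \sum_(l < size B) M r 0 l *: B`_l).
      under [RHS]eq_bigr => r _ do rewrite mulrBr.
      rewrite sumrB [X in _ = _ - X](_ : _ = 0).
        by rewrite subr0; apply: eq_bigr => r _; rewrite -mul_mpolyC mulrCA.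
      under eq_bigr => r _ do rewrite mulr_sumr.
      rewrite exchange_big big1 //= => l _.
      transitivity (((x *m A) 0 l) *: B`_l); last by rewrite xA mxE scale0r.
      rewrite mxE scaler_suml; apply: eq_bigr => r _.
      by rewrite mul_mpolyC scalerA [A r l]mxE.
    by apply: ideal_sum => // r _; apply: (idealM idJ).
  have hg : g \is k.-homog by apply: rpred_sum => r _; rewrite dhomogZ.
  have gE' : g = \sum_(i < 3) pihomog mdeg e (d i) * mderiv i f.
    rewrite -[LHS](pihomog_dE hg) gE (raddf_sum (pihomog mdeg k)) /=.
    apply: eq_bigr => j _; rewrite -(@pihomogM _ _ D) ?mderiv_homog //.
    by rewrite /k addnC.
  pose y (i : 'I_3) : 'rV_(size (monomials e)) :=
    \row_r (pihomog mdeg e (d i))@_(nth 0%MM (monomials e) r).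
  have -> : x = y 0 *m N 0 + y 1%R *m N 1%R + y 2%:R *m N 2%:R.
    apply/rowP => l; rewrite -(coef_X_monomials x l) -/g gE' sum3 !mcoeffD !mxE.
    have yE (j : 'I_3) : (pihomog mdeg e (d j) * mderiv j f)@_(nth 0%MM (monomials k) l) =
        \sum_r y j 0 r * N j r l.
      rewrite {1}(homog_monomials (pihomogP mdeg e (d j))) mulr_suml.
      rewrite (raddf_sum (mcoeff _)) /=; apply: eq_bigr => r _.
      by rewrite !mxE -scalerAl mcoeffZ.
    by rewrite !yE.
  by rewrite !addmx_sub_adds ?submxMl.
have := mxrankS sub; rewrite mxrank_ker.
have rA := rank_leq_col A.
have rN (i : 'I_3) : (\rank (N i) <= 'C(e + 2, 2))%N.
  by rewrite -size_monomials; exact: rank_leq_row.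
have := rN 0; have := rN 1%R; have := rN 2%:R.
have := (mxrank_adds_leqif (N 0) (N 1%R)).1.
have := (mxrank_adds_leqif (N 0 + N 1%R)%MS (N 2%:R)).1.
move: (size_monomials k) sB rA; rewrite -/k.
move: (\rank _) (\rank _) (\rank _) (\rank _) (\rank _) (\rank _).
move: (size (monomials k)); clear; lia.
Qed.

(** The degree [D./2 - 1] maximizes ['C(D + e + 2, 2) - 3 * 'C(e + 2, 2)] over [e]; the maximum is
    [3 * D ^ 2 / 4] for even [D] and [1 / 4] more for odd [D]. *)
Lemma free_arith D b : (2 < D.+1)%N ->
  ('C(D + (D./2).-1 + 2, 2) <= 3 * 'C((D./2).-1 + 2, 2) + (D.+1 * D - b))%N ->
  (b <= D.+1 * D)%N -> (4 * b <= D ^ 2 + 4 * D)%N.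
Proof.
move=> D2 H leb.
have bin n : ('C(n + 2, 2) * 2 = (n + 2) * (n + 1))%N.
  by rewrite mulnC -mul_bin_diag bin1 addn2 addn1 mulnC.
have [h [e [eD eh e1]]] : exists (h e : nat),
    [/\ D = (2 * h + 2 + e)%N, (D./2).-1 = h & (e <= 1)%N].
  exists (D./2).-1, (odd D : nat); split=> //; last by case: (odd D).
  by have := odd_double_half D; lia.
have := bin (D + h)%N; have := bin h; move: H; rewrite eh.
move: 'C(D + h + 2, 2) 'C(h + 2, 2) => c1 c2 H b2 b1.
have {}H : (c1 + b <= 3 * c2 + D.+1 * D)%N by lia.
subst D; case: e e1 H b1 {leb D2 eh} => [|[|//]] _ H b1; nia.
Qed.

Lemma free_betti (pt : I -> I -> P) s : (2 < size s)%N -> uniq s ->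
  {in s, forall i, av i != 0} ->
  {in s &, forall i j, i != j -> cross (av i) (av j) != 0} ->
  {in s & &, forall h i j, i != h -> j != h ->
     (pt h i == pt h j) = (vol (av h) (av i) (av j) == 0)} ->
  free_curve (arr s) ->
  (4 * betti pt s <= (size s).-1 ^ 2 + 4 * (size s).-1)%N.
Proof.
move=> s_gt2 us nz0 nz ptE free.
have sn0 : s != [::] by rewrite -size_eq0; lia.
(* The cross products are the intersection points, so [w] is a line through none of them. *)
have [w hw] : exists w, {in [seq cross (av u.1) (av u.2) | u <-
    [seq (i, j) | i <- s, j <- s] & u.1 != u.2], forall v, dot v w != 0}.
  apply: generic_vector; apply/allP => v /mapP[[i j]].
  rewrite mem_filter => /andP[/= ne /allpairsP[[i' j'] /= [si sj [ei ej]]] ->].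
  by rewrite -ei -ej in si sj; exact: nz.
have irr : irrelevant (adjoin (jacobian (arr s)) (linform w)).
  apply: generic_irrelevant => // i j si sj ne; apply: hw.
  apply/mapP; exists (i, j) => //; rewrite mem_filter ne /=.
  by apply/allpairsP; exists (i, j).
have [k0 codim] := codim_jacobian sn0 us nz0 nz ptE.
have := @free_codim (arr s) (size s).-1 ((size s).-1./2).-1 w k0
  (size s * (size s).-1 - betti pt s).
rewrite prednK ?(ltn_trans _ s_gt2) // => /(_ (arr_homog av s)).
move=> /(_ (fun g => saturated_regular free irr)) H.
have {H} : ('C((size s).-1 + ((size s).-1./2).-1 + 2, 2) <=
    3 * 'C(((size s).-1./2).-1 + 2, 2) + (size s * (size s).-1 - betti pt s))%N.
  apply: H => k /codim[B sB sp]; exists B => //; lia.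
have : (betti pt s <= size s * (size s).-1)%N.
  by have [B sB _] := codim k0 (leqnn _); apply: leq_trans sB; rewrite leq_addl.
by move: (betti pt s) s_gt2; case: (size s) => // D b /= D2 leb H; exact: free_arith H leb.
Qed.

End Freeness.

(** * Chambers of a real arrangement *)

Section Chambers.
Local Open Scope ring_scope.
Variables (R : realFieldType) (I : finType) (av : I -> 'rV[R]_3).
Implicit Types (x y v w : 'rV[R]_3) (B s : {set I}) (t : seq I) (i j k : I).

Definition sign s i : R := if i \in s then 1 else -1.

Lemma sg_neq0 s i : sign s i != 0.
Proof. by rewrite /sign; case: ifP => _; rewrite ?oppr_eq0 oner_eq0. Qed.

Lemma sg_flip s i j : i != j -> sign (i |: s) j = sign s j.
Proof. by move=> ne; rewrite /sign !inE eq_sym (negPf ne). Qed.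

Lemma sg_del s i j : i != j -> sign (s :\ i) j = sign s j.
Proof. by move=> ne; rewrite /sign !inE eq_sym ne. Qed.

Definition pos s B x := {in B, forall i, 0 < sign s i * dot (av i) x}.

Definition annih t x := {in t, forall i, dot (av i) x = 0}.

(* A sign vector on B is encoded by the set of its positive lines; the vectors
   realizing it are restricted to the common zeros of t. *)
Definition cham t B : {set {set I}} :=
  [set s in powerset B | `[< exists2 x, annih t x & pos s B x >]].

Lemma chamP t B s : reflect (s \subset B /\ exists2 x, annih t x & pos s B x)
  (s \in cham t B).
Proof.
rewrite !inE; apply: (iffP andP) => [[-> /asboolP //]|[-> ex]].
by split=> //; apply/asboolP.
Qed.

Lemma small_perturbation (T : eqType) (r : seq T) (u w : T -> R) :
  {in r, forall z, 0 < u z} ->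
  exists2 e, 0 < e & forall d, `|d| <= e -> {in r, forall z, 0 < u z + d * w z}.
Proof.
elim: r => [|z r IHr] u0; first by exists 1.
have [|e e0 He] := IHr; first by move=> a ra; apply: u0; rewrite inE ra orbT.
have uz := u0 z (mem_head z r); have w1 : 0 < `|w z| + 1 by rewrite ltr_wpDl.
(* Adding 1 keeps the denominator positive when [w z = 0], and makes the inequality strict. *)
exists (Num.min e (u z / (`|w z| + 1))).
  by rewrite lt_min e0 divr_gt0.
move=> d; rewrite le_min ler_pdivlMr // => /andP[de du] a.
rewrite inE => /predU1P[->|ra]; last exact: He.
have [->|d0] := eqVneq d 0; first by rewrite mul0r addr0.
have : - `|d * w z| <= d * w z by rewrite lerNnormlW.
have : 0 < `|d| by rewrite normr_gt0.
by move: du; rewrite mulrDr mulr1 -normrM; lra.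
Qed.

Lemma pos_perturbation s B x v : pos s B x ->
  exists2 e, 0 < e & forall d, `|d| <= e -> pos s B (x + d *: v).
Proof.
move=> px; have [|e e0 He] := @small_perturbation _ (enum B)
    (fun i => sign s i * dot (av i) x) (fun i => sign s i * dot (av i) v).
  by move=> i; rewrite mem_enum => /px.
exists e => // d /He{}He i Bi; rewrite dotDr dotZr mulrDr (mulrCA (sign s i) d).
by apply: He; rewrite mem_enum.
Qed.

Lemma pos_sub s B B' x : B' \subset B -> pos s B x -> pos s B' x.
Proof. by move=> /subsetP sub px i /sub/px. Qed.

Lemma eq_pos s s' B x : {in B, sign s =1 sign s'} -> pos s B x -> pos s' B x.
Proof. by move=> e px i Bi; rewrite -e //; apply: px. Qed.

(** The chambers of [B] meeting the positive side of [i] if [b] holds, the negative side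
    otherwise. *)
Definition side (b : bool) t B i : {set {set I}} := [set s in powerset B |
  `[< exists x, [/\ annih t x, pos s B x & 0 < (if b then 1 else -1) * dot (av i) x] >]].

Lemma sideP b t B i s : reflect (s \subset B /\
   exists x, [/\ annih t x, pos s B x & 0 < (if b then 1 else -1) * dot (av i) x])
  (s \in side b t B i).
Proof.
rewrite !inE; apply: (iffP andP) => [[-> /asboolP //]|[-> ex]].
by split=> //; apply/asboolP.
Qed.

Lemma side_neq B i s b t : i \notin B -> s \in side b t B i ->
  {in B, forall j, i != j} /\ i \notin s.
Proof.
move=> iB /sideP[/subsetP sB _]; split; last by apply: contra iB => /sB.
by move=> j Bj; apply: contraNneq iB => ->.
Qed.

Lemma mem_cham_setU1 t B i s : i \notin B -> s \subset B ->
  (i |: s \in cham t (i |: B)) = (s \in side true t B i).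
Proof.
move=> iB sB; have ne j : j \in B -> i != j by move=> Bj; apply: contraNneq iB => ->.
apply/chamP/sideP => [[_ [x ax px]]|[_ [x [ax px ix]]]].
  split=> //; exists x; split=> //.
    apply: eq_pos (pos_sub (subsetUr [set i] _) px) => j Bj.
    by rewrite sg_flip ?ne.
  by have := px i (setU11 _ _); rewrite /sign setU11.
split; first exact: setUS.
exists x => // j; rewrite in_setU1 => /predU1P[->|Bj]; first by rewrite /sign setU11.
by rewrite sg_flip ?ne ?px.
Qed.

Lemma mem_cham_notin t B i s : i \notin B -> s \subset B ->
  (s \in cham t (i |: B)) = (s \in side false t B i).
Proof.
move=> iB sB; have is_ : i \notin s by apply: contra iB => /(subsetP sB).
apply/chamP/sideP => [[_ [x ax px]]|[_ [x [ax px ix]]]].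
  split=> //; exists x; split=> //.
    by apply: pos_sub px; apply: subsetUr.
  by have := px i (setU11 _ _); rewrite /sign (negPf is_).
split; first exact: subset_trans sB (subsetUr _ _).
exists x => // j; rewrite in_setU1 => /predU1P[->|Bj]; last exact: px.
by rewrite /sign (negPf is_).
Qed.

(** Chambers are convex, so one that meets both sides of [i] meets [i]; conversely a vector on [i]
    moves to either side along [y]. *)
Lemma sides_inter t B i y : annih t y -> dot (av i) y != 0 ->
  side true t B i :&: side false t B i = cham (i :: t) B.
Proof.
move=> ay iy; apply/setP => s; rewrite inE; apply/andP/chamP.
  move=> [/sideP[sB [x [ax px ix]]] /sideP[_ [z [az pz iz]]]]; split=> //.
  rewrite mul1r in ix; rewrite mulN1r oppr_gt0 in iz.
  exists (- dot (av i) z *: x + dot (av i) x *: z) => j.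
    rewrite inE dotDr !dotZr => /predU1P[->|tj]; first by ring.
    by rewrite (ax j tj) (az j tj) !mulr0 addr0.
  move=> Bj; rewrite dotDr !dotZr mulrDr !(mulrCA (sign s j)).
  by apply: addr_gt0; apply: mulr_gt0; rewrite ?oppr_gt0 ?px ?pz.
move=> [sB [x ax px]]; have [e e0 He] := pos_perturbation y px.
have ix : dot (av i) x = 0 by apply: ax; rewrite mem_head.
pose d := e * Num.sg (dot (av i) y).
have nd : `|d| <= e by rewrite normrM normr_sg iy mulr1 gtr0_norm.
have dy : 0 < d * dot (av i) y.
  by rewrite -mulrA -normrEsg mulr_gt0 ?normr_gt0.
have annD c : annih t (x + c *: y).
  by move=> j tj; rewrite dotDr dotZr ay // mulr0 addr0 ax // inE tj orbT.
split; apply/sideP; split=> //.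
- exists (x + d *: y); split=> //; first exact: He.
  by rewrite dotDr dotZr ix add0r mul1r.
- exists (x + - d *: y); split=> //; first by apply: He; rewrite normrN.
  by rewrite dotDr dotZr ix add0r mulrA mulrNN mul1r.
Qed.

Lemma sides_union t B i y : annih t y -> dot (av i) y != 0 ->
  side true t B i :|: side false t B i = cham t B.
Proof.
move=> ay iy; apply/setP => s; rewrite inE; apply/orP/chamP.
  by move=> [] /sideP[sB [x [ax px ix]]]; split=> //; exists x.
move=> [sB [x ax px]].
have [xn|xp|x0] := ltgtP (dot (av i) x) 0.
- by right; apply/sideP; split=> //; exists x; split=> //; rewrite mulN1r oppr_gt0.
- by left; apply/sideP; split=> //; exists x; split=> //; rewrite mul1r.
have : s \in cham (i :: t) B.
  by apply/chamP; split=> //; exists x => // j; rewrite inE => /predU1P[->|/ax].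
by rewrite -(sides_inter B ay iy) inE => /andP[->]; left.
Qed.

(** Deletion and restriction: adding [i] yields one chamber for each element of either side, and the
    two sides have union [cham t B] and intersection [cham (i :: t) B]. *)
Lemma card_cham_setU1 t B i y : i \notin B -> annih t y -> dot (av i) y != 0 ->
  #|cham t (i |: B)| = (#|cham t B| + #|cham (i :: t) B|)%N.
Proof.
move=> iB ay iy; rewrite -(sides_inter B ay iy) -(sides_union B ay iy) cardsUI.
have sub b s : s \in side b t B i -> s \subset B by case/sideP.
have ni b s : s \in side b t B i -> i \notin s by move=> /(side_neq iB)[].
have -> : cham t (i |: B) = [set i |: s | s in side true t B i] :|: side false t B i.
  apply/setP => s; rewrite in_setU; apply/idP/orP.
    case: (boolP (i \in s)) => si cs; have /chamP[sB _] := cs.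
      have sB' : s :\ i \subset B by rewrite subDset.
      left; apply/imsetP; exists (s :\ i); last by rewrite setD1K.
      by rewrite -mem_cham_setU1 // setD1K.
    have sB' : s \subset B.
      apply/subsetP => j sj; have := subsetP sB j sj.
      by rewrite in_setU1 => /predU1P[e|//]; rewrite -e sj in si.
    by right; rewrite -mem_cham_notin.
  move=> [/imsetP[s' hs' ->]|hs].
    by rewrite mem_cham_setU1 // (sub _ _ hs').
  by rewrite mem_cham_notin // (sub _ _ hs).
have e0 : [set i |: s | s in side true t B i] :&: side false t B i = set0.
  apply/setP => s; rewrite in_setI in_set0; apply/negP => /andP[/imsetP[s' _ ->] h].
  by have := ni _ _ h; rewrite setU11.
rewrite cardsU e0 cards0 subn0 card_in_imset // => s s' hs hs' e.
by rewrite -(setU1K (ni _ _ hs)) e setU1K // (ni _ _ hs').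
Qed.

End Chambers.

Section Kernels.
Local Open Scope ring_scope.
Variable K : numFieldType.
Implicit Types a b v x : 'rV[K]_3.

Lemma solve_dot a b (p q : K) : cross a b != 0 -> exists v, dot a v = p /\ dot b v = q.
Proof.
move=> /vec_neq0P[u abu]; exists (p *: cross b u + q *: cross u a).
have e1 : dot a (cross b u) = 1 by rewrite -abu !dotE !crossE; ring.
have e2 : dot b (cross u a) = 1 by rewrite -abu !dotE !crossE; ring.
by rewrite !dotDr !dotZr e1 e2 dot_crossl dot_crossr; split; ring.
Qed.

Lemma annih_cross a b x : cross a b != 0 -> dot a x = 0 -> dot b x = 0 ->
  exists k, x = k *: cross a b.
Proof.
move=> ab0 ax bx; apply: (cross_eq0 ab0).
by rewrite crossC cross_cross (dotC x b) (dotC x a) ax bx !scale0r subr0 oppr0.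
Qed.

End Kernels.

(** * The number of chambers *)

Section Count.
Local Open Scope ring_scope.
Variables (R : realFieldType) (I : finType) (P : eqType) (av : I -> 'rV[R]_3)
  (pt : I -> I -> P).
Hypothesis nz0 : forall i, av i != 0.
Hypothesis nz : forall i j, i != j -> cross (av i) (av j) != 0.
Hypothesis ptE : forall h i j, i != h -> j != h ->
  (pt h i == pt h j) = (vol (av h) (av i) (av j) == 0).
Implicit Types (x y v w : 'rV[R]_3) (B s : {set I}) (t r : seq I) (i j k : I).
Local Notation cham := (cham av).

Lemma cham_set0 t : cham t set0 = [set set0].
Proof.
apply/setP => s; rewrite in_set1; apply/chamP/eqP => [[sB _]|->].
  by apply/eqP; rewrite -subset0.
split; first exact: sub0set.
by exists 0 => j; [rewrite dot0r|rewrite inE].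
Qed.

Lemma cham_pair0 i j k B : i != j -> k \in B -> vol (av i) (av j) (av k) = 0 ->
  cham [:: j; i] B = set0.
Proof.
move=> ne Bk vol0; apply/setP => s; rewrite in_set0; apply/chamP => -[_ [x ax px]].
have [c xE] := annih_cross (nz ne) (ax i (mem_last j [:: i])) (ax j (mem_head _ _)).
by have := px k Bk; rewrite xE dotZr dotC -/(vol _ _ _) vol0 !mulr0 ltxx.
Qed.

(** The common zeros of [i] and [j] off the origin form two opposite rays. They have opposite signs
    on [B], and these differ because [B] is not empty. *)
Lemma card_cham_pair i j B : i != j -> B != set0 ->
  {in B, forall k, vol (av i) (av j) (av k) != 0} -> #|cham [:: j; i] B| = 2%N.
Proof.
move=> ne /set0Pn[k0 Bk0] volB; pose w := cross (av i) (av j).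
pose s1 := [set k in B | 0 < dot (av k) w].
have wk k : k \in B -> dot (av k) w != 0 by rewrite dotC; apply: volB.
have ann c : annih av [:: j; i] (c *: w).
  move=> k; rewrite !inE => /orP[]/eqP->; rewrite dotZr.
    by rewrite dot_crossr mulr0.
  by rewrite dot_crossl mulr0.
have -> : cham [:: j; i] B = [set s1; B :\: s1].
  apply/setP => s; rewrite in_set2; apply/chamP/orP.
    move=> [sB [x ax px]].
    have [c xE] := annih_cross (nz ne) (ax i (mem_last j [:: i])) (ax j (mem_head _ _)).
    have pB k : k \in B -> 0 < sign R s k * c * dot (av k) w.
      by move=> /px; rewrite xE dotZr mulrA.
    have [c0|c0|c0] := ltgtP c 0.
    - right; apply/eqP/setP => k; rewrite !inE; apply/idP/andP => [sk|[]].
        have Bk := subsetP sB k sk; split=> //; have := pB k Bk.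
        rewrite /sign sk mul1r nmulr_rgt0 // Bk /= => lt; rewrite -leNgt; exact: ltW.
      move=> + Bk; rewrite Bk /= -leNgt => le; have := pB k Bk; rewrite /sign.
      case: ifP => // _; rewrite mulN1r mulNr oppr_gt0 nmulr_rlt0 //.
      by rewrite ltNge le.
    - left; apply/eqP/setP => k; rewrite !inE; apply/idP/andP => [sk|[Bk gt]].
        have Bk := subsetP sB k sk; split=> //; have := pB k Bk.
        by rewrite /sign sk mul1r pmulr_rgt0.
      have := pB k Bk; rewrite /sign; case: ifP => // _.
      by rewrite mulN1r mulNr oppr_gt0 pmulr_rlt0 // ltNge ltW.
    - by have := pB k0 Bk0; rewrite c0 mulr0 mul0r ltxx.
  move=> [] /eqP->; split.
  - by apply/subsetP => k; rewrite inE => /andP[].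
  - exists (1 *: w) => // k Bk; rewrite scale1r /sign inE Bk /=.
    have := wk k Bk; have [lt|gt|e] // := ltgtP (dot (av k) w) 0.
      by rewrite mulN1r oppr_gt0.
    by rewrite mul1r.
  - exact: subsetDl.
  - exists (- 1 *: w) => // k Bk; rewrite scaleN1r dotNr /sign !inE Bk /= andbT.
    have := wk k Bk; have [lt|gt|e] // := ltgtP (dot (av k) w) 0.
      by rewrite mul1r oppr_gt0.
    by rewrite mulN1r opprK.
rewrite cards2 (_ : _ != _) //; apply/eqP => /setP/(_ k0).
by rewrite !inE Bk0 andbT /=; case: (_ < _).
Qed.

Lemma set_cons i r : [set k in i :: r] = i |: [set k in r].
Proof. by apply/setP => k; rewrite !inE. Qed.

(** Each new point on [i] adds its two opposite rays as cuts, hence two chambers of the restriction;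
    a point already present adds none. *)
Lemma card_cham1 i r : uniq (i :: r) -> r != [::] ->
  #|cham [:: i] [set k in r]| = (2 * size (undup [seq pt i k | k <- r]))%N.
Proof.
elim: r => // j r IHr /= /andP[]; rewrite inE negb_or => /andP[ij ir] /andP[jr ur] _.
rewrite set_cons; have [y [iy jy]] := solve_dot 0 1 (nz ij).
rewrite (@card_cham_setU1 _ _ _ _ _ _ y) ?inE //; last by rewrite jy oner_eq0.
- have [->|rn0] := eqVneq r [::].
    rewrite (_ : [set k in [::]] = set0); last by apply/setP => k; rewrite !inE.
    by rewrite !cham_set0 !cards1.
  rewrite IHr //=; last by rewrite ir.
  have nei k : k \in r -> k != i by move=> rk; apply: contraNneq ir => <-.
  have ji : j != i by rewrite eq_sym.
  case: ifP => [/mapP[k rk e]|nin] /=.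
    rewrite (@cham_pair0 i j k) ?cards0 ?addn0 ?inE //.
    by apply/eqP; rewrite -(ptE ji (nei k rk)) e.
  rewrite card_cham_pair //; first by rewrite mulnS addnC.
    by case: (r) rn0 => // k r' _; apply/set0Pn; exists k; rewrite !inE eqxx.
  move=> k; rewrite inE => rk; rewrite -(ptE ji (nei k rk)).
  by apply: contraFneq nin => ->; rewrite map_f.
- by move=> k; rewrite inE => /eqP->.
Qed.

Lemma card_cham0 i r : uniq (i :: r) ->
  #|cham [::] [set k in i :: r]| = (2 * (betti pt (i :: r)).+1)%N.
Proof.
elim: r i => [|j r IHr] i; rewrite set_cons.
  move=> _; rewrite (_ : [set k in [::]] = set0); last by apply/setP => k; rewrite !inE.
  have [u e] := vec_neq0P (nz0 i).
  by rewrite (@card_cham_setU1 _ _ _ _ _ _ u) ?inE ?e ?oner_eq0 // !cham_set0 !cards1.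
move=> uijr; have /andP[ijr ujr] : (i \notin j :: r) && uniq (j :: r) by [].
have [u e] := vec_neq0P (nz0 i).
rewrite (@card_cham_setU1 _ _ _ _ _ _ u) ?e ?oner_eq0 //; last by rewrite inE.
by rewrite IHr // card_cham1 // (betti_cons pt i (j :: r)) -addSn mulnDr.
Qed.

End Count.

(** * Walls and Melchior's inequality *)

Section Walls.
Local Open Scope ring_scope.
Variables (R : realFieldType) (I : finType) (P : eqType) (av : I -> 'rV[R]_3)
  (pt : I -> I -> P).
Hypothesis nz0 : forall i, av i != 0.
Hypothesis nz : forall i j, i != j -> cross (av i) (av j) != 0.
Hypothesis ptE : forall h i j, i != h -> j != h ->
  (pt h i == pt h j) = (vol (av h) (av i) (av j) == 0).
Hypothesis nontrivial : forall v, v != 0 -> exists i, dot (av i) v != 0.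
Hypothesis card_gt1 : (1 < #|I|)%N.
Implicit Types (x y v w : 'rV[R]_3) (B s W : {set I}) (t r : seq I) (i j k : I).
Local Notation cham := (cham av).
Local Notation pos := (pos av).
Local Notation sg := (@sign R I).

Definition chambers : {set {set I}} := cham [::] setT.

Definition flip i s := if i \in s then s :\ i else i |: s.

(** A wall is recorded through the neighbouring chamber, whose signs differ at [i] only, so that no
    faces need to be described. *)
Definition walls s : {set I} := [set i | flip i s \in chambers].

Definition npoints i : nat := size (undup [seq pt i k | k <- enum I & k != i]).

Lemma chambersP s : reflect (exists x, pos s setT x) (s \in chambers).
Proof.
apply: (iffP (chamP _ _ _ _)) => [[_ [x _ px]]|[x px]]; first by exists x.
by split; [exact: subsetT|exists x].
Qed.

Lemma sg_flip_neq i j s : i != j -> sg (flip i s) j = sg s j.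
Proof. by move=> ne; rewrite /flip; case: ifP => _; rewrite ?sg_del ?sg_flip. Qed.

Lemma sg_flip_eq i s : sg (flip i s) i = - sg s i.
Proof. by rewrite /flip /sign; case: (boolP (i \in s)) => _; rewrite ?setD11 ?setU11 ?opprK. Qed.

Lemma sg_sqr s i : sg s i * sg s i = 1.
Proof. by rewrite /sign; case: ifP => _; rewrite ?mulrNN mulr1. Qed.

Lemma card_chambers : #|chambers| = (2 * (betti pt (enum I)).+1)%N.
Proof.
rewrite /chambers (_ : setT = [set k in enum I]); last first.
  by apply/setP => k; rewrite !inE mem_enum.
have : uniq (enum I) by exact: enum_uniq.
have : size (enum I) = #|I| by rewrite -cardE.
case e : (enum I) => [|i r] /= sI ur; first by move: card_gt1; rewrite -sI.
exact: card_cham0.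
Qed.

(** Two chambers separated by [i] alone restrict to the same chamber on [i]. There are
    [2 * npoints i] chambers on [i], and each accounts for two chambers of the arrangement. *)
Lemma card_walls_le : (\sum_(s in chambers) #|walls s| <= 4 * \sum_i npoints i)%N.
Proof.
have -> : (\sum_(s in chambers) #|walls s| =
    \sum_i #|[set s in chambers | flip i s \in chambers]|)%N.
  under eq_bigr => s _ do rewrite -sum1_card.
  under [RHS]eq_bigr => i _ do rewrite -sum1_card.
  rewrite (exchange_big_dep predT) //=; apply: eq_bigr => i _.
  by apply: eq_bigl => s; rewrite !inE.
rewrite big_distrr /=; apply: leq_sum => i _.
pose B : {set I} := ~: [set i]; have iB : i \notin B by rewrite !inE eqxx.
have BT : setT = i |: B by rewrite setUCr.
have [u iu] := vec_neq0P (nz0 i).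
have ann : annih av [::] u by [].
have iu0 : dot (av i) u != 0 by rewrite iu oner_eq0.
have cardD : #|cham [:: i] B| = (2 * npoints i)%N.
  rewrite /npoints -(card_cham1 nz ptE) //.
  - congr #|cham _ _|; first by apply/setP => k; rewrite !inE mem_filter mem_enum andbT.
  - by rewrite /= filter_uniq ?enum_uniq // mem_filter eqxx.
  - move: card_gt1; rewrite (cardD1 i) inE add1n ltnS lt0n; apply: contraNneq => e.
    rewrite -(eq_card0 (A := mem (Nil I))) //; apply/eqP/eq_card => k.
    by rewrite -e mem_filter mem_enum !inE.
apply: (@leq_trans (2 * #|cham [:: i] B|)%N); last by rewrite cardD mulnA.
have sub : [set s in chambers | flip i s \in chambers] \subset
    cham [:: i] B :|: [set i |: s | s in cham [:: i] B].
  apply/subsetP => s; rewrite inE => /andP[cs cf]; rewrite in_setU.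
  have key s' : i \notin s' -> s' \in chambers -> i |: s' \in chambers -> s' \in cham [:: i] B.
    move=> is' cs' cs''; have sB' : s' \subset B.
      by apply/subsetP => j sj; rewrite !inE; apply: contraNneq is' => <-.
    rewrite -(sides_inter B ann iu0) inE.
    by rewrite -mem_cham_setU1 // -mem_cham_notin // -BT cs' cs''.
  move: cf; rewrite /flip; case: ifP => si cf.
    apply/orP; right; apply/imsetP; exists (s :\ i); last by rewrite setD1K.
    by apply: key; rewrite ?setD11 ?setD1K.
  by apply/orP; left; apply: key; rewrite ?si.
apply: leq_trans (subset_leq_card sub) _; apply: leq_trans (leq_card_setU _ _) _.
by rewrite mul2n -addnn leq_add2l leq_imset_card.
Qed.

(* A minimal subset of the inequalities defining the chamber consists of walls. *)
Lemma walls_suffice s : s \in chambers -> forall y, pos s (walls s) y -> pos s setT y.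
Proof.
move=> /chambersP[x0 px0]; pose Q W := `[< forall y, pos s W y -> pos s setT y >].
have [W /minsetP[/asboolP QW minW] _] : {W | minset Q W & W \subset setT}.
  by apply: minset_exists; apply/asboolP.
suff sub : W \subset walls s by move=> y /(pos_sub sub)/QW.
apply/subsetP => i Wi; have [y pyW npy] : exists2 y, pos s (W :\ i) y & ~ pos s setT y.
  apply: contrapT => nex; have /minW/(_ (subsetDl _ _)) e : Q (W :\ i).
    by apply/asboolP => y py; apply: contrapT => npy; apply: nex; exists y.
  by move: Wi; rewrite -e setD11.
have iy : sg s i * dot (av i) y <= 0.
  rewrite leNgt; apply/negP => iy; apply/npy/QW => k Wk.
  have [->//|ne] := eqVneq k i.
  by apply: pyW; rewrite !inE ne.
have ix := px0 i (in_setT i).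
(* Up to scaling, the point of the segment from [x0] to [y] that lies on [i]. *)
pose z := (- (sg s i * dot (av i) y)) *: x0 + (sg s i * dot (av i) x0) *: y.
have iz : sg s i * dot (av i) z = 0 by rewrite dotDr !dotZr; ring.
have pzW : pos s (W :\ i) z.
  move=> k Wk; rewrite dotDr !dotZr mulrDr !(mulrCA (sg s k)).
  apply: ltr_wpDl; last by apply: mulr_gt0 => //; apply: pyW.
  by apply: mulr_ge0; rewrite ?oppr_ge0 // ltW // px0.
have pz : pos s (setT :\ i) z.
  move=> k; rewrite !inE andbT => ki; rewrite ltNge; apply/negP => kz.
  have ik : i != k by rewrite eq_sym.
  (* If the inequality of [k] fails at [z], a small move along [v] makes that of [i] strict and
     leaves that of [k] violated, although all of [W] then holds. *)
  have [v [iv kv]] := solve_dot (sg s i) (- sg s k) (nz ik).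
  have [e e0 He] := pos_perturbation v pzW.
  have /QW/(_ k (in_setT k)) : pos s W (z + e *: v).
    move=> l Wl; have [->|li] := eqVneq l i.
      by rewrite dotDr dotZr iv mulrDr iz add0r mulrCA sg_sqr mulr1.
    by apply: He; rewrite ?gtr0_norm // !inE li.
  rewrite dotDr dotZr kv mulrDr mulrN mulrN mulrCA sg_sqr mulr1.
  by move: kz e0; lra.
have [e e0 He] := pos_perturbation x0 pz.
(* Moving from [z] slightly away from [x0] crosses [i] and no other line. *)
rewrite inE; apply/chambersP; exists (z + - e *: x0) => k _.
have [->|ki] := eqVneq k i.
  rewrite sg_flip_eq dotDr dotZr mulNr mulrDr iz add0r mulrCA -mulNr opprK.
  exact: mulr_gt0.
rewrite sg_flip_neq 1?eq_sym //; apply: He; first by rewrite normrN gtr0_norm.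
by rewrite !inE ki.
Qed.

Lemma subset_pair W : (#|W| <= 2)%N -> exists i j, i != j /\ W \subset [set i; j].
Proof.
move=> W2; have other i : exists j, i != j.
  have : (0 < #|[set~ i]|)%N by rewrite cardsC1; move: card_gt1; lia.
  by move=> /card_gt0P[j]; rewrite !inE eq_sym; exists j.
have [->|/set0Pn[i Wi]] := eqVneq W set0.
  have /card_gt0P[i _] : (0 < #|I|)%N by apply: ltn_trans card_gt1.
  by have [j ne] := other i; exists i, j; rewrite sub0set.
have [e|/set0Pn[j]] := eqVneq (W :\ i) set0.
  have [j ne] := other i; exists i, j; split=> //.
  by rewrite -(setD1K Wi) e setU0 subsetUl.
move=> Wj; exists i, j; have := Wj; rewrite !inE eq_sym => /andP[ne _]; split=> //.
rewrite -(setD1K Wi) setUS // -(setD1K Wj) (_ : W :\ i :\ j = set0) ?setU0 //.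
apply/eqP; rewrite -cards_eq0; move: W2.
by rewrite (cardsD1 i) Wi (cardsD1 j) Wj; lia.
Qed.

(** If all walls were among [i] and [j], translations along their common point would preserve the
    chamber, yet they reach any line [k] not through that point. *)
Lemma card_walls_ge3 s : s \in chambers -> (3 <= #|walls s|)%N.
Proof.
move=> cs; rewrite ltnNge; apply/negP => /subset_pair[i [j [ne sub]]].
have /chambersP[x0 px0] := cs; pose v := cross (av i) (av j).
have [k kv] := nontrivial (nz ne : v != 0).
have : pos s setT (x0 + (- dot (av k) x0 / dot (av k) v) *: v).
  apply: walls_suffice => // l /(subsetP sub); rewrite !inE dotDr dotZr.
  by move=> /orP[]/eqP->; rewrite ?dot_crossl ?dot_crossr mulr0 addr0 px0 ?inE.
by move=> /(_ k (in_setT k)); rewrite dotDr dotZr divfK // subrr mulr0 ltxx.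
Qed.

(** Count pairs of a chamber and one of its walls, with at least three walls for each chamber. *)
Lemma melchior : (3 * (betti pt (enum I)).+1 <= 2 * \sum_i npoints i)%N.
Proof.
have : (3 * #|chambers| <= 4 * \sum_i npoints i)%N.
  apply: leq_trans card_walls_le; rewrite mulnC -sum_nat_const.
  by apply: leq_sum => s; apply: card_walls_ge3.
by rewrite card_chambers; lia.
Qed.

(** * Equality in Melchior's inequality *)

Section Simplicial.
Hypothesis extremal : (2 * \sum_i npoints i = 3 * (betti pt (enum I)).+1)%N.
Hypothesis no_near_pencil : forall c v, v != 0 -> exists2 k, k != c & dot (av k) v != 0.

Lemma simplicial s : s \in chambers -> #|walls s| = 3%N.
Proof.
move=> cs; apply/eqP; rewrite eqn_leq card_walls_ge3 // andbT leqNgt.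
apply/negP => gt3; have := card_walls_le; rewrite (bigD1 s) //=.
have : (3 * #|chambers :\ s| <= \sum_(s' in chambers | s' != s) #|walls s'|)%N.
  rewrite mulnC -sum_nat_const.
  rewrite [X in (X <= _)%N](eq_bigl (fun s' => (s' \in chambers) && (s' != s))).
    by apply: leq_sum => s' /andP[cs' _]; apply: card_walls_ge3.
  by move=> s'; rewrite in_setD1 andbC.
have := card_chambers; rewrite (cardsD1 s) cs; move: extremal gt3.
move: (\sum_i _) (betti _ _) #|walls s| #|chambers :\ s| (\sum_(s' in chambers | s' != s) _).
by move=> x1 x2 x3 x4 x5; rewrite (_ : nat_of_bool true = 1%N) //; clear; lia.
Qed.

(** The point of [i] and [j] is a double point. Pairs are ordered, so each double point is counted
    twice. *)
Definition dbl i j := (i != j) &&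
  [forall k, (k != i) && (k != j) ==> (vol (av i) (av j) (av k) != 0)].

(* One of the two rays over the point of i and j is an edge of s. *)
Definition adj s i j := s :\: [set i; j] \in cham [:: j; i] (~: [set i; j]).

Lemma adjP s i j : reflect (exists2 x, dot (av i) x = 0 /\ dot (av j) x = 0 &
  pos s (~: [set i; j]) x) (adj s i j).
Proof.
have e : {in ~: [set i; j], sg (s :\: [set i; j]) =1 sg s}.
  by move=> k; rewrite inE => nk; rewrite /sign in_setD nk.
apply: (iffP (chamP _ _ _ _)) => [[_ [x ax px]]|[x [ix jx] px]].
  exists x; last exact: eq_pos px.
  by rewrite !ax // !inE eqxx ?orbT.
split; first by apply/subsetP => k; rewrite !inE => /andP[].
exists x; first by move=> k; rewrite !inE => /orP[]/eqP->.
by apply: eq_pos px => k nk; rewrite e.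
Qed.

Lemma adj_sym s i j : adj s i j = adj s j i.
Proof.
apply/adjP/adjP => -[x [ix jx] px]; exists x => //; by rewrite setUC.
Qed.

Lemma dbl_sym i j : dbl i j = dbl j i.
Proof.
rewrite /dbl eq_sym; congr (_ && _); apply: eq_forallb => k.
by rewrite andbC /vol crossC dotC dotNr oppr_eq0 dotC.
Qed.

Lemma adj_flip s i j : adj s i j -> adj (flip i s) i j.
Proof.
move=> /adjP[x x0 px]; apply/adjP; exists x => //; apply: eq_pos px => k.
by rewrite !inE negb_or => /andP[ki _]; rewrite sg_flip_neq // eq_sym.
Qed.

(** From the ray over the point, step slightly into the sector where [i] and [j] have the signs of
    [s]. *)
Lemma adj_chambers s i j : i != j -> adj s i j -> s \in chambers.
Proof.
move=> ne /adjP[x [ix jx] px]; have [v [iv jv]] := solve_dot (sg s i) (sg s j) (nz ne).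
have [e e0 He] := pos_perturbation v px.
apply/chambersP; exists (x + e *: v) => k _.
have [->|ki] := eqVneq k i.
  by rewrite dotDr dotZr ix iv add0r mulrCA sg_sqr mulr1.
have [->|kj] := eqVneq k j.
  by rewrite dotDr dotZr jx jv add0r mulrCA sg_sqr mulr1.
by apply: He; rewrite ?gtr0_norm // !inE negb_or ki kj.
Qed.

Lemma adj_walls s i j : i != j -> adj s i j -> i \in walls s.
Proof. by move=> ne /adj_flip a; rewrite inE; apply: adj_chambers a. Qed.

(* If two vertices of a triangle were double points, the other triangle with
   the same two vertices would be cut out by the same three lines, and the
   remaining lines would all pass through the third vertex. *)
Lemma adj_unique s c a b : dbl c a -> dbl c b -> adj s c a -> adj s c b -> a = b.
Proof.
move=> /andP[ca _] /andP[cb _] sca scb; apply/eqP/contraT => ab.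
have wallsE s' : adj s' c a -> adj s' c b -> walls s' = [set c; a; b].
  move=> aa bb; apply/esym/eqP; rewrite eqEcard (simplicial (adj_chambers ca aa)).
  rewrite !subUset !sub1set (adj_walls ca aa).
  rewrite (@adj_walls s' a c) ?(@adj_walls s' b c) -1?adj_sym 1?eq_sym //=.
  by rewrite setUC cardsU1 cards2 !inE negb_or !(eq_sym b) ca cb ab.
have cs := adj_chambers ca sca; have cs' := adj_chambers ca (adj_flip sca).
have W := wallsE _ sca scb; have W' := wallsE _ (adj_flip sca) (adj_flip scb).
pose v := cross (av a) (av b); have [k kc kv] := no_near_pencil c (nz ab : v != 0).
have ka : k != a by apply: contraNneq kv => ->; rewrite dot_crossl.
have kb : k != b by apply: contraNneq kv => ->; rewrite dot_crossr.
(* On its side of [c], [y] satisfies the three wall inequalities of [s] or of [flip c s], and both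
   chambers have the same sign at [k]. *)
have key1 y : pos s [set a; b] y -> dot (av c) y != 0 -> 0 < sg s k * dot (av k) y.
  move=> py cy; have [cneg|cpos|c0] := ltgtP (sg s c * dot (av c) y) 0.
  - rewrite -(@sg_flip_neq c) 1?eq_sym //.
    apply: (walls_suffice cs'); rewrite ?in_setT // W' => l; rewrite !inE -orbA.
    move=> /orP[/eqP->|lab]; first by rewrite sg_flip_eq mulNr oppr_gt0.
    rewrite sg_flip_neq; first by apply: py; rewrite !inE.
    by apply: contraTneq lab => <-; rewrite negb_or ca cb.
  - apply: (walls_suffice cs); rewrite ?in_setT // W => l; rewrite !inE -orbA.
    by move=> /orP[/eqP->//|lab]; apply: py; rewrite !inE.
  - by move/eqP: c0; rewrite mulf_eq0 (negPf (sg_neq0 _ _ _)) (negPf cy).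
(* A point on [c] is the midpoint of two nearby points off [c]. *)
have key y : pos s [set a; b] y -> 0 < sg s k * dot (av k) y.
  move=> py; have [c0|] := eqVneq (dot (av c) y) 0; last exact: key1.
  have [u cu] := vec_neq0P (nz0 c); have [e e0 He] := pos_perturbation u py.
  have h d : `|d| = e -> 0 < sg s k * dot (av k) (y + d *: u).
    move=> de; apply: key1; first by apply: He; rewrite de.
    by rewrite dotDr dotZr c0 cu add0r mulr1 -normr_eq0 de gt_eqF.
  have := h e (gtr0_norm e0); have := h (- e); rewrite normrN => /(_ (gtr0_norm e0)).
  by rewrite !dotDr !dotZr mulNr !mulrDr mulrN; lra.
have /chambersP[x0 px0] := cs.
(* Moving along the common point of [a] and [b] keeps their signs but reaches [k]. *)
have : pos s [set a; b] (x0 + (- dot (av k) x0 / dot (av k) v) *: v).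
  move=> l; rewrite !inE dotDr dotZr.
  by move=> /orP[]/eqP->; rewrite ?dot_crossl ?dot_crossr mulr0 addr0 px0 ?inE.
by move=> /key; rewrite dotDr dotZr divfK // subrr mulr0 ltxx.
Qed.

(** Two such pairs sharing a line coincide up to order by [adj_unique], and disjoint ones would give
    a triangle four walls. *)
Lemma card_adj_dbl s :
  (#|[set p | dbl p.1 p.2 && adj s p.1 p.2]| <= 2)%N.
Proof.
set E := [set _ | _]; have [->|/set0Pn[[i j]]] := eqVneq E set0; first by rewrite cards0.
rewrite inE /= => /andP[dij aij]; have /andP[ij _] := dij.
have cs := adj_chambers ij aij.
apply: (@leq_trans #|[set (i, j); (j, i)]|); last by rewrite cards2; case: (_ != _).
apply: subset_leq_card; apply/subsetP => -[k l]; rewrite !inE /= => /andP[dkl akl].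
have /andP[kl _] := dkl.
have sym p q : dbl p q -> adj s p q -> dbl q p * adj s q p.
  by move=> d a; rewrite dbl_sym adj_sym d a.
have [dji aji] := sym _ _ dij aij; have [dlk alk] := sym _ _ dkl akl.
rewrite !xpair_eqE.
have [ki|ki] := eqVneq k i.
  by subst k; rewrite (adj_unique dij dkl aij akl) eqxx.
have [kj|kj] := eqVneq k j.
  by subst k; rewrite (adj_unique dji dkl aji akl) eqxx.
have [li|li] := eqVneq l i.
  by subst l; move: kj; rewrite (adj_unique dij dlk aij alk) eqxx.
have [lj|lj] := eqVneq l j.
  by subst l; move: ki; rewrite (adj_unique dji dlk aji alk) eqxx.
have : (#|[set i; j; k; l]| <= #|walls s|)%N.
  apply: subset_leq_card; rewrite !subUset !sub1set (adj_walls ij aij).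
  rewrite (adj_walls kl akl) (adj_walls _ aji) 1?eq_sym //.
  by rewrite (adj_walls _ alk) 1?eq_sym.
by rewrite simplicial // setUC cardsU1 setUC cardsU1 cards2 !inE !negb_or
  li lj (eq_sym l) kl ki kj ij.
Qed.

(** Around each of the two opposite rays over a double point the signs of [i] and [j] are arbitrary:
    two rays times four sign choices. *)
Lemma card_adj_ge i j : (2 < #|I|)%N -> dbl i j -> (8 <= #|[set s | adj s i j]|)%N.
Proof.
move=> I2 /andP[ij /forallP dij]; pose B := ~: [set i; j].
have cB : #|cham [:: j; i] B| = 2%N.
  apply: (card_cham_pair nz ij).
    by rewrite -card_gt0; have := cardsC [set i; j]; rewrite cards2 ij -/B; lia.
  by move=> k; rewrite !inE negb_or => nk; have := dij k; rewrite nk.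
pose D := setX (cham [:: j; i] B) (powerset [set i; j]).
have <- : #|D| = 8%N by rewrite cardsX cB card_powerset cards2 ij.
have split2 p : p \in D -> ((p.1 :|: p.2) :\: [set i; j] = p.1) *
    ((p.1 :|: p.2) :&: [set i; j] = p.2).
  case: p => s1 s2; rewrite in_setX /= powersetE => /andP[/chamP[s1B _] s2ij].
  rewrite setDUl setIUl (setIidPl s2ij).
  have /eqP-> : s2 :\: [set i; j] == set0 by rewrite setD_eq0.
  have dis : [disjoint s1 & [set i; j]] by rewrite disjoints_subset.
  by rewrite (disjoint_setI0 dis) set0U setU0 (setDidPl dis).
rewrite -(card_in_imset (f := fun p => p.1 :|: p.2) (D := D)); last first.
  move=> [s1 s2] [s1' s2'] /split2[e1 e2] /split2[e1' e2'] /= e.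
  by move: e1 e2 e1' e2'; rewrite /= e => -> -> -> ->.
apply: subset_leq_card; apply/subsetP => _ /imsetP[p pD ->].
by rewrite inE /adj split2 //; move: pD; rewrite -/B; case: p => ? ?; rewrite in_setX => /andP[].
Qed.

(** Count incidences of ordered pairs and chambers: at least 8 for each pair, at most 2 for each of
    the [2 * (b + 1)] chambers, where [b] is the [betti] number. *)
Lemma double_points_le : (2 < #|I|)%N ->
  (2 * #|[set p | dbl p.1 p.2]| <= (betti pt (enum I)).+1)%N.
Proof.
move=> I2; rewrite -(leq_pmul2l (isT : 0 < 4)%N).
have -> : (4 * (betti pt (enum I)).+1 = #|chambers| * 2)%N.
  by rewrite card_chambers; lia.
rewrite mulnA -sum_nat_const.
apply: (@leq_trans (\sum_(p | dbl p.1 p.2) \sum_(s in chambers | adj s p.1 p.2) 1)%N).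
  rewrite mulnC -sum_nat_const big_mkcond [X in (_ <= X)%N]big_mkcond /=.
  apply: leq_sum => -[i j] _; rewrite inE; case: ifP => // dij /=.
  rewrite sum1dep_card; apply: leq_trans (card_adj_ge I2 dij) _.
  apply: subset_leq_card; apply/subsetP => s; rewrite in_set => aij.
  by rewrite in_set aij andbT; apply: adj_chambers aij; case/andP: dij.
rewrite (exchange_big_dep (mem chambers)) /=; last by move=> p s _ /andP[].
apply: leq_sum => s cs; apply: leq_trans (card_adj_dbl s).
rewrite sum1dep_card; apply: subset_leq_card; apply/subsetP => p.
by rewrite in_set => /and3P[d _ a]; rewrite in_set d a.
Qed.

End Simplicial.
End Walls.

(** * Counting points and lines *)

Section Incidence.
Variables (T Q : eqType) (on : Q -> T -> bool) (meet : T -> T -> Q).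
Variables (s : seq T) (X : seq Q).
Hypothesis us : uniq s.
Hypothesis uX : uniq X.
Hypothesis onE : {in s &, forall h k, h != k -> forall P, on P h && on P k = (P == meet h k)}.
Hypothesis meetX : {in s &, forall h k, h != k -> meet h k \in X}.
Implicit Types (r : seq T) (h k : T) (P : Q).

Local Notation deg r P := (count (on P) r).

Lemma meet_off r h k : {subset h :: r <= s} -> uniq (h :: r) -> k \in r ->
  [/\ h \in s, k \in s & h != k].
Proof.
move=> sub /= /andP[hr _] rk; split; [by apply: sub; rewrite mem_head| |].
  by apply: sub; rewrite inE rk orbT.
by apply: contraNneq hr => ->.
Qed.

Lemma count_points_on r h : {subset h :: r <= s} -> uniq (h :: r) ->
  \sum_(P <- X) (on P h && (0 < deg r P)) = size (undup [seq meet h k | k <- r]).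
Proof.
move=> sub ur.
have -> : \sum_(P <- X) (on P h && (0 < deg r P)) =
    size [seq P <- X | on P h && (0 < deg r P)].
  by rewrite size_filter -sum1_count [RHS]big_mkcond /=; apply: eq_bigr => P _; case: ifP.
apply: perm_size; apply: uniq_perm; rewrite ?filter_uniq ?undup_uniq // => P.
rewrite mem_undup mem_filter -has_count.
apply/idP/mapP => [/andP[/andP[Ph /hasP[k rk Pk]] _]|[k rk ->]].
  exists k => //; have [sh sk hk] := meet_off sub ur rk.
  by apply/eqP; rewrite -(onE sh sk hk) Ph.
have [sh sk hk] := meet_off sub ur rk.
have := onE sh sk hk (meet h k); rewrite eqxx => /andP[-> mk].
by rewrite meetX // andbT; apply/hasP; exists k.
Qed.

(** Adding a line raises the summand by one exactly at the points of the line that already lie on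
    another one. *)
Lemma sum_deg_betti : \sum_(P <- X) (deg s P).-1 = betti meet s.
Proof.
suff H r : uniq r -> {subset r <= s} -> \sum_(P <- X) (deg r P).-1 = betti meet r.
  exact: H.
elim: r => [|h r IHr] /=; first by rewrite big1.
move=> ur sub; rewrite -IHr; first 1 last.
- by case/andP: ur.
- by move=> k rk; apply: sub; rewrite inE rk orbT.
rewrite -(count_points_on sub ur) -big_split /=; apply: eq_bigr => P _.
by case: (on P h) => /=; case: (deg r P) => [|n]; rewrite /= ?addn0 ?addn1.
Qed.

Lemma sum_deg_bin2 : \sum_(P <- X) 'C(deg s P, 2) = 'C(size s, 2).
Proof.
suff H r : uniq r -> {subset r <= s} -> \sum_(P <- X) 'C(deg r P, 2) = 'C(size r, 2).
  exact: H.
elim: r => [|h r IHr] /=; first by rewrite big1.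
move=> ur sub; rewrite binS bin1 -IHr; first 1 last.
- by case/andP: ur.
- by move=> k rk; apply: sub; rewrite inE rk orbT.
have -> : size r = \sum_(P <- X) (on P h * deg r P).
  under eq_bigr => P _ do rewrite -sum1_count big_mkcond big_distrr /=.
  rewrite exchange_big /= -sum1_size !big_seq; apply: eq_bigr => k rk.
  have [sh sk hk] := meet_off sub ur rk.
  under eq_bigr => P _.
    rewrite (_ : _ * _ = nat_of_bool (P == meet h k)); last first.
      by rewrite -(onE sh sk hk); case: (on P h); case: (on P k).
    over.
  rewrite -big_mkcond /= sum1_count.
  by have := count_uniq_mem (meet h k) uX; rewrite meetX.
rewrite -big_split /=; apply: eq_bigr => P _.
by case: (on P h) => /=; rewrite ?mul1n ?addn0 // add1n binS bin1.
Qed.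

Lemma sum_deg_points : \sum_(P <- X | 1 < deg s P) deg s P =
  \sum_(h <- s) size (undup [seq meet h k | k <- s & k != h]).
Proof.
have -> : \sum_(h <- s) size (undup [seq meet h k | k <- s & k != h]) =
    \sum_(h <- s) \sum_(P <- X) (on P h && (1 < deg s P)).
  rewrite !big_seq; apply: eq_bigr => h sh; rewrite -count_points_on.
  - apply: eq_bigr => P _; case Ph : (on P h) => //=.
    rewrite (permP (perm_to_rem sh)) /= Ph rem_filter // add1n ltnS.
  - by move=> k; rewrite inE mem_filter => /predU1P[->//|/andP[]].
  - by rewrite /= mem_filter eqxx filter_uniq.
rewrite exchange_big /= big_mkcond; apply: eq_bigr => P _; case: ifP => _.
  by rewrite -sum1_count big_mkcond; apply: eq_bigr => h _; rewrite andbT; case: on.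
by rewrite big1 // => h _; rewrite andbF.
Qed.

Lemma deg_meet h k : h \in s -> k \in s -> h != k -> 1 < deg s (meet h k).
Proof.
move=> sh sk hk; have := onE sh sk hk (meet h k); rewrite eqxx => /andP[mh mk].
rewrite (permP (perm_to_rem sh)) /= mh add1n ltnS -has_count.
by apply/hasP; exists k; rewrite ?mem_rem_uniq ?inE 1?eq_sym ?hk.
Qed.

Lemma deg_meet3 h k l : h \in s -> k \in s -> l \in s -> h != k -> l != h -> l != k ->
  on (meet h k) l -> 2 < deg s (meet h k).
Proof.
move=> sh sk sl hk lh lk ml.
have := onE sh sk hk (meet h k); rewrite eqxx => /andP[mh mk].
rewrite -size_filter; apply: (@uniq_leq_size _ [:: h; k; l]).
  by rewrite /= !inE negb_or hk eq_sym lh eq_sym lk.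
by move=> z; rewrite !inE mem_filter => /or3P[]/eqP->; rewrite ?mh ?mk ?ml.
Qed.

End Incidence.

Lemma sum_deg_eval (Q : eqType) (X : seq Q) (c : Q -> nat) (f : nat -> nat) :
  {in X, forall P, 1 < c P <= 4} ->
  \sum_(P <- X) f (c P) = count (fun P => c P == 2) X * f 2 +
    count (fun P => c P == 3) X * f 3 + count (fun P => c P == 4) X * f 4.
Proof.
elim: X => [|P X IHX] cX; first by rewrite big_nil.
rewrite big_cons IHX => [|P' XP']; last by apply: cX; rewrite inE XP' orbT.
have := cX P (mem_head P X) => /=.
by case: (c P) => [|[|[|[|[|c']]]]] //= _; rewrite !add0n !add1n mulSn ?addnA //; lia.
Qed.

(** The fibres of [pt] over the elements of [r] are disjoint, and each contains a pair in both
    orders. *)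
Lemma card_fibre_pairs (I : finType) (Q : eqType) (pt : I -> I -> Q) (D : rel I) (r : seq Q) :
  uniq r ->
  {in r, forall P, exists i j, [/\ i != j, D i j, D j i, pt i j = P & pt j i = P]} ->
  2 * size r <= #|[set p | D p.1 p.2]|.
Proof.
move=> ur rD.
apply: (@leq_trans (\sum_(P <- r) #|[set p | D p.1 p.2 && (pt p.1 p.2 == P)]|)).
  rewrite -sum1_size big_distrr /= !big_seq; apply: leq_sum => P /rD[i [j [ij dij dji eij eji]]].
  rewrite muln1.
  have <- : #|[set (i, j); (j, i)]| = 2 by rewrite cards2 xpair_eqE (negPf ij).
  apply: subset_leq_card; apply/subsetP => p; rewrite !inE => /orP[]/eqP-> /=.
    by rewrite dij eij eqxx.
  by rewrite dji eji eqxx.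
rewrite -sum1dep_card; under eq_bigr => P _ do rewrite -sum1dep_card big_mkcondr /=.
rewrite exchange_big; apply: leq_sum => p _ /=.
rewrite -big_mkcond sum1_count; have := count_uniq_mem (pt p.1 p.2) ur.
by rewrite (eq_count (a2 := pred1 (pt p.1 p.2))) => [->|P]; [case: (_ \in _)|rewrite /= eq_sym].
Qed.

(** * The numerical constraints *)

Definition numeric_constraints (d n2 n3 n4 : nat) : bool :=
  [&& n2 + 3 * n3 + 6 * n4 == (d * d.-1)./2,
      4 * (n2 + 2 * n3 + 3 * n4) <= d.-1 ^ 2 + 4 * d.-1,
      n4 + 3 <= n2 &
      (n2 == n4 + 3) && (5 < d) ==> (4 * n2 <= (n2 + 2 * n3 + 3 * n4).+1)].

(** Let [b = n2 + 2 n3 + 3 n4], [C = n2 + 3 n3 + 6 n4] and [D = d - 1]. Then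
    [7 b - 4 C = 3 (n2 - n4) + 2 n3 >= 9], and inserting the bounds on [b] and [C] gives
    [(D - 2) (D - 18) <= 0] for positive [d]. *)
Lemma numeric_constraints_le d n2 n3 n4 : numeric_constraints d n2 n3 n4 -> d <= 19.
Proof.
move=> /and4P[/eqP e le1 le2 _]; case: d e le1 => // d /= e le1.
have : 2 * (n2 + 3 * n3 + 6 * n4) = d.+1 * d.
  by rewrite e; have := odd_double_half (d.+1 * d); rewrite oddM /= andNb; lia.
by move: le1 le2; clear; nia.
Qed.

(** The number of pairs of lines determines [n2]; where the subtraction truncates to a wrong value,
    the first constraint fails. *)
Definition numeric_check (d n4 n3 : nat) : bool :=
  let n2 := (d * d.-1)./2 - 3 * n3 - 6 * n4 in
  numeric_constraints d n2 n3 n4 ==> (d <= 18) && ((n2, n3, n4) \in admissible_triples d).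

(** At most 19 lines form at most 171 pairs, so [n3 <= 57] and [n4 <= 28]. *)
Lemma numeric_check_all :
  all (fun d => all (fun n4 => all (numeric_check d n4) (iota 0 58)) (iota 0 29)) (iota 3 17).
Proof. by vm_compute. Qed.

Lemma numeric_constraints_list d n2 n3 n4 : 2 < d -> numeric_constraints d n2 n3 n4 ->
  3 <= d <= 18 /\ (n2, n3, n4) \in admissible_triples d.
Proof.
move=> d3 nc; have d19 := numeric_constraints_le nc.
have /and4P[/eqP e _ _ _] := nc.
have le171 : (d * d.-1)./2 <= 171.
  rewrite (_ : 171 = half (19 * 18)) //; apply: half_leq; apply: leq_mul => //.
  by move: d19; clear; lia.
have hd : d \in iota 3 17 by rewrite mem_iota; move: d3 d19; clear; lia.
have h4 : n4 \in iota 0 29 by rewrite mem_iota; move: e le171; clear; lia.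
have h3 : n3 \in iota 0 58 by rewrite mem_iota; move: e le171; clear; lia.
have := allP (allP (allP numeric_check_all d hd) n4 h4) n3 h3.
rewrite /numeric_check (_ : _ - _ - _ = n2); last by move: e; clear; lia.
by rewrite nc => /andP[-> ->]; rewrite d3.
Qed.

(** * Points and lines of the projective plane *)

Section Lines.
Local Open Scope ring_scope.
Variables (K : numFieldType) (A : {fset line K}) (ell : line K -> 'rV[K]_3).
Hypothesis ellP : forall H, H \in A -> defines (ell H) H.
Implicit Types (H L M : line K) (Q : point K) (v : 'rV[K]_3).

Local Notation s := (enum_fset A).

Lemma dim_span v : v != 0 -> \dim <[v]>%VS == 1%N.
Proof. by move=> nz; rewrite dim_vline nz. Qed.

Lemma mem_line H v : H \in s -> (v \in val H) = (dot (ell H) v == 0).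
Proof. by move=> sH; rewrite (ellP sH). Qed.

Lemma point_vec Q : exists2 v, v != 0 & val Q = <[v]>%VS.
Proof.
have /eqP dQ := valP Q; exists (vpick (val Q)).
  by rewrite vpick0 -dimv_eq0 dQ.
apply/esym/eqP; rewrite eqEdim -memvE memv_pick dQ dim_vline.
by rewrite vpick0 -dimv_eq0 dQ.
Qed.

Lemma on_lineE Q v H : H \in s -> val Q = <[v]>%VS ->
  on_line Q H = (dot (ell H) v == 0).
Proof. by move=> sH e; rewrite /on_line e -memvE mem_line. Qed.

Lemma ell_neq0 H : H \in s -> ell H != 0.
Proof.
move=> sH; apply/negP => /eqP e; have /eqP dH := valP H.
have : (fullv <= val H)%VS.
  apply/subvP => v _; rewrite mem_line // e dotE !mxE; apply/eqP; ring.
by move=> /dimvS; rewrite dH dimvf.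
Qed.

Lemma cross_neq0 H L : H \in s -> L \in s -> H != L -> cross (ell H) (ell L) != 0.
Proof.
move=> sH sL; apply: contraNneq => /(cross_eq0 (ell_neq0 sH))[k e].
have k0 : k != 0.
  by apply: contraNneq (ell_neq0 sL) => k0; rewrite e k0 scale0r.
apply/eqP/val_inj/vspaceP => v; rewrite !mem_line // e dotZl.
by rewrite mulf_eq0 (negPf k0).
Qed.


Lemma on_meet H L Q : H \in s -> L \in s -> H != L ->
  on_line Q H && on_line Q L = (val Q == <[cross (ell H) (ell L)]>%VS).
Proof.
move=> sH sL HL; have HLn := cross_neq0 sH sL HL.
apply/andP/eqP => [[]|e].
  have [v v0 e] := point_vec Q; rewrite !(on_lineE _ e) // => /eqP Hv /eqP Lv.
  have [k vE] := annih_cross HLn Hv Lv; rewrite e; apply/eqP.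
  by rewrite eqEdim !dim_vline v0 HLn andbT -memvE vE memvZ ?memv_line.
by rewrite !(on_lineE _ e) // dot_crossl dot_crossr.
Qed.

Lemma span_point v : v != 0 -> exists Q : point K, val Q = <[v]>%VS.
Proof.
move=> nz; have d := dim_span nz.
by exists (exist (fun U : {vspace 'rV[K]_3} => \dim U == 1%N) _ d).
Qed.

Lemma meet_exists : exists meet : line K -> line K -> point K,
  {in s &, forall H L, H != L -> val (meet H L) = <[cross (ell H) (ell L)]>%VS}.
Proof.
(* [Q0] is the default value of [meet] outside the pairs of distinct lines of [A]. *)
have [Q0 _] : exists Q : point K, True.
  have [|Q _] := @span_point (delta_mx 0 0); last by exists Q.
  by apply/eqP => /rowP/(_ 0)/eqP; rewrite !mxE oner_eq0.
have ex u : exists Q : point K, u.1 \in s -> u.2 \in s -> u.1 != u.2 ->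
    val Q = <[cross (ell u.1) (ell u.2)]>%VS.
  case: (boolP [&& u.1 \in s, u.2 \in s & u.1 != u.2]) => [/and3P[s1 s2 ne]|].
    by have [Q e] := span_point (cross_neq0 s1 s2 ne); exists Q.
  by move=> not; exists Q0 => s1 s2 ne; rewrite s1 s2 ne in not.
have [f fE] := choice ex; exists (fun H L => f (H, L)) => H L sH sL.
exact: (fE (H, L)).
Qed.

End Lines.

Lemma multE (K : fieldType) (A : {fset line K}) (Q : point K) :
  mult A Q = count (on_line Q) (enum_fset A).
Proof.
rewrite /mult -size_filter; apply: perm_size; apply: uniq_perm.
- exact: fset_uniq.
- by rewrite filter_uniq // fset_uniq.
- by move=> H; rewrite !inE mem_filter andbC.
Qed.

Lemma nptsE (K : fieldType) (A : {fset line K}) (X : seq (point K)) k : uniq X ->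
  (1 < k)%N -> (forall Q, (1 < mult A Q)%N -> Q \in X) ->
  npts A k = count (fun Q => mult A Q == k) X.
Proof.
move=> uX k1 XA; rewrite /npts -size_filter; apply: perm_size; apply: uniq_perm.
- exact: fset_uniq.
- by rewrite filter_uniq.
move=> Q; rewrite cardinality.in_fset_set; last exact: finite_mult.
rewrite mem_filter; apply/idP/andP => [/classical_sets.set_mem /= e|[/eqP e _]];
  last exact/classical_sets.mem_set.
by rewrite e eqxx XA // e.
Qed.

Lemma betti_map (T I Q : eqType) (f : I -> T) (m : T -> T -> Q) (r : seq I) :
  betti (fun i j => m (f i) (f j)) r = betti m (map f r).
Proof. by elim: r => //= i r ->; rewrite -map_comp. Qed.

Lemma betti_npoints (T : choiceType) (Q : eqType) (A : {fset T}) (m : T -> T -> Q) :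
  (\sum_(i : A) npoints (fun i j => m (val i) (val j)) i =
  \sum_(h <- enum_fset A) size (undup [seq m h k | k <- enum_fset A & k != h]))%N.
Proof.
rewrite enum_fsetE big_map big_enum; apply: eq_bigr => i _.
by rewrite /npoints [in RHS]filter_map -[in RHS]map_comp; congr (size (undup (map _ _))).
Qed.

Lemma betti_fset (T : choiceType) (Q : eqType) (A : {fset T}) (m : T -> T -> Q) :
  betti (fun i j : A => m (val i) (val j)) (enum {: A}) = betti m (enum_fset A).
Proof. by rewrite [in RHS]enum_fsetE; exact: (betti_map val). Qed.

(** * From real to complex coefficients *)

Section Complexification.
Local Open Scope ring_scope.
Variable R : rcfType.
Local Notation cplx := (map_mx (real_complex R)).

Lemma cross_map (a b : 'rV[R]_3) : cross (cplx a) (cplx b) = cplx (cross a b).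
Proof. by apply/rowP => i; rewrite !mxE rmorphB !rmorphM. Qed.

Lemma dot_map (a b : 'rV[R]_3) : dot (cplx a) (cplx b) = real_complex R (dot a b).
Proof. by rewrite !dotE !mxE !rmorphD !rmorphM. Qed.

Lemma map_eq0 (a : 'rV[R]_3) : (cplx a == 0) = (a == 0).
Proof. by rewrite map_mx_eq0. Qed.

End Complexification.

(** * The constraints for a free real arrangement *)

Section FreeRealArrangements.
Local Open Scope ring_scope.
Variables (R : realType) (A : {fset line R}) (ell : line R -> 'rV[R]_3)
  (meet : line R -> line R -> point R).
Hypothesis ellP : forall H, H \in A -> defines (ell H) H.
Local Notation s := (enum_fset A).
Hypothesis meetE :
  {in s &, forall H L, H != L -> val (meet H L) = <[cross (ell H) (ell L)]>%VS}.
Hypothesis nontriv : ~ trivial_arr A.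
Hypothesis mult4 : forall Q, (mult A Q <= 4)%N.

Let X : seq (point R) := undup [seq meet u.1 u.2 |
  u <- [seq (H, L) | H <- s, L <- s] & u.1 != u.2].

Lemma on_meetE : {in s &, forall H L, H != L -> forall Q,
  on_line Q H && on_line Q L = (Q == meet H L)}.
Proof.
move=> H L sH sL HL Q; rewrite (on_meet ellP) // -(meetE sH sL HL).
by rewrite (inj_eq val_inj).
Qed.

Lemma meet_X : {in s &, forall H L, H != L -> meet H L \in X}.
Proof.
move=> H L sH sL HL; rewrite mem_undup; apply/mapP; exists (H, L) => //.
by rewrite mem_filter HL /=; apply/allpairsP; exists (H, L).
Qed.

Lemma mem_X Q : (1 < mult A Q)%N -> Q \in X.
Proof.
rewrite multE => Q2; have us : uniq (filter (on_line Q) s).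
  by rewrite filter_uniq // fset_uniq.
move: Q2 us; rewrite -size_filter; case e : (filter _ s) => [|H [|L r]] //= _.
rewrite inE negb_or => /andP[/andP[HL _] _].
have : H \in filter (on_line Q) s by rewrite e mem_head.
have : L \in filter (on_line Q) s by rewrite e !inE eqxx orbT.
rewrite !mem_filter => /andP[QL sL] /andP[QH sH].
have /eqP-> : Q == meet H L by rewrite -on_meetE // QH QL.
exact: meet_X.
Qed.

Lemma mult_X : {in X, forall Q, 1 < count (on_line Q) s <= 4}%N.
Proof.
move=> Q; rewrite -multE mult4 andbT mem_undup => /mapP[[H L]].
rewrite mem_filter => /= /andP[HL /allpairsP[[H' L'] /= [sH sL [eH eL]]] ->].
by subst H' L'; rewrite multE; apply: deg_meet on_meetE _ _ sH sL HL.
Qed.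

Lemma meet_vol H L M : L \in s -> H \in s -> M \in s -> L != H -> M != H ->
  (meet H L == meet H M) = (vol (ell H) (ell L) (ell M) == 0).
Proof.
move=> sL sH sM LH MH; rewrite -on_meetE 1?eq_sym //.
have HL : H != L by rewrite eq_sym.
rewrite !(on_lineE ellP _ (meetE sH sL HL)) // dot_crossl eqxx /=.
by rewrite /vol dotC.
Qed.

Lemma nontriv_vec v : v != 0 -> exists2 H, H \in s & dot (ell H) v != 0.
Proof.
move=> v0; apply: contrapT => nex; apply: nontriv.
have [Q e] := span_point v0; exists Q => H sH.
rewrite (on_lineE ellP sH e); apply: contrapT => /negP nz.
by apply: nex; exists H.
Qed.

(** At most one line always leaves a point common to all lines, which makes the arrangement
    trivial. *)
Lemma size_gt1 : (1 < size s)%N.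
Proof.
rewrite ltnNge; apply/negP => le1.
have [v v0 hv] : exists2 v, v != 0 & {in s, forall H, dot (ell H) v = 0}.
  case: s le1 (fun H => @ell_neq0 _ A ell ellP H) => [|H [|//]] _ nz0.
    exists (const_mx 1); last by [].
    by apply/eqP => /rowP/(_ 0)/eqP; rewrite !mxE oner_eq0.
  have := nz0 H (mem_head _ _); set a := ell H => a0.
  have [[i ci]|nex] := pselect (exists i, cross a (delta_mx 0 i) != 0).
    by exists (cross a (delta_mx 0 i)) => // L; rewrite inE => /eqP->; rewrite dot_crossl.
  have z i : cross a (delta_mx 0 i) = 0.
    by apply: contrapT => /eqP ne; apply: nex; exists i.
  case/eqP: a0; have := z 0; have := z 1 => /rowP z1 /rowP z0.
  apply: row3P; rewrite !mxE.
  - by have := z1 2%:R; rewrite crossE !mxE /=; lra.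
  - by have := z0 2%:R; rewrite crossE !mxE /=; lra.
  - by have := z0 1; rewrite crossE !mxE /=; lra.
have [H sH] := nontriv_vec v0.
by rewrite hv // eqxx.
Qed.

Let n k := count (fun Q => mult A Q == k) X.

Lemma npts_count k : (1 < k)%N -> npts A k = n k.
Proof. by move=> k1; apply: nptsE mem_X => //; exact: undup_uniq. Qed.

Let countE k : count (fun Q => count (on_line Q) s == k) X = n k.
Proof. by apply: eq_count => Q; rewrite /= multE. Qed.

Lemma betti_count : betti meet s = (n 2 + 2 * n 3 + 3 * n 4)%N.
Proof.
rewrite -(sum_deg_betti (fset_uniq A) (undup_uniq _) on_meetE meet_X).
rewrite (sum_deg_eval (fun m => m.-1) mult_X) !countE /=; lia.
Qed.

Lemma bin2_count : 'C(size s, 2) = (n 2 + 3 * n 3 + 6 * n 4)%N.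
Proof.
rewrite -(sum_deg_bin2 (fset_uniq A) (undup_uniq _) on_meetE meet_X).
rewrite (sum_deg_eval (fun m => 'C(m, 2)) mult_X) !countE /=.
rewrite (_ : 'C(2, 2) = 1%N) // (_ : 'C(3, 2) = 3%N) // (_ : 'C(4, 2) = 6%N) //; lia.
Qed.

Lemma points_count :
  (\sum_(h <- s) size (undup [seq meet h k | k <- s & k != h]) =
   2 * n 2 + 3 * n 3 + 4 * n 4)%N.
Proof.
rewrite -(sum_deg_points (fset_uniq A) (undup_uniq _) on_meetE meet_X).
rewrite big_mkcond (sum_deg_eval (fun m => if 1 < m then m else 0)%N mult_X) !countE /=; lia.
Qed.

Let av (i : A) := ell (val i).
Let pt (i j : A) := meet (val i) (val j).

Let av_neq0 i : av i != 0.
Proof. exact: (ell_neq0 ellP (valP i)). Qed.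

Let val_neq (i j : A) : i != j -> val i != val j.
Proof. by rewrite (inj_eq val_inj). Qed.

Let av_cross i j : i != j -> cross (av i) (av j) != 0.
Proof. by move=> /val_neq; apply: (cross_neq0 ellP (valP i) (valP j)). Qed.

Let av_pt h i j : i != h -> j != h ->
  (pt h i == pt h j) = (vol (av h) (av i) (av j) == 0).
Proof.
move=> /val_neq ih /val_neq jh.
exact: (meet_vol (valP i) (valP h) (valP j) ih jh).
Qed.

Let av_nontriv v : v != 0 -> exists i, dot (av i) v != 0.
Proof. by move=> /nontriv_vec[H sH nz]; exists [` sH]%fset. Qed.

Let card_A : #|{: A}| = size s.
Proof. by rewrite -cardfE. Qed.

Let betti_A : betti pt (enum {: A}) = betti meet s.
Proof. exact: betti_fset. Qed.

(** Substituting the counts into [melchior], the terms in [n 3] cancel. *)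
Lemma melchior_count : (n 4 + 3 <= n 2)%N.
Proof.
have card_gt1 : (1 < #|{: A}|)%N by rewrite card_A size_gt1.
have := melchior av_neq0 av_cross av_pt av_nontriv card_gt1.
rewrite betti_A betti_npoints points_count betti_count; lia.
Qed.

(** Otherwise all lines except possibly [c], at least five of them, would pass through one point,
    against the bound 4 on multiplicities. *)
Lemma no_near_pencil : (5 < size s)%N -> forall (c : A) v, v != 0 ->
  exists2 k, k != c & dot (av k) v != 0.
Proof.
move=> s5 c v v0; apply: contrapT => nex.
have [Q e] := span_point v0; have := mult4 Q; rewrite multE leqNgt => /negP; apply.
have sub : {subset [seq H <- s | H != val c] <= [seq H <- s | on_line Q H]}.
  move=> H; rewrite !mem_filter => /andP[Hc sH]; rewrite sH andbT.
  rewrite (on_lineE ellP sH e); apply: contrapT => /negP nz.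
  by apply: nex; exists [` sH]%fset => //; apply: contra Hc => /eqP <-.
rewrite -size_filter; apply: leq_trans (uniq_leq_size _ sub).
  by rewrite -rem_filter ?fset_uniq // size_rem; [move: s5; case: (size s)|exact: valP].
by rewrite filter_uniq // fset_uniq.
Qed.

Lemma dbl_deg2 i j : i != j -> count (on_line (pt i j)) s = 2%N -> dbl av i j.
Proof.
move=> ij c2; rewrite /dbl ij; apply/forallP => k; apply/implyP => /andP[ki kj].
apply/negP => /eqP vol0.
have := @deg_meet3 _ _ _ _ _ on_meetE (val i) (val j) (val k) (valP i) (valP j) (valP k).
rewrite c2 ltnn => /(_ (val_neq ij) (val_neq ki) (val_neq kj)) H; suff : false by []; apply: H.
rewrite (on_lineE ellP (valP k) (meetE (valP i) (valP j) (val_neq ij))) dotC.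
exact/eqP.
Qed.

Lemma double_count : (2 * n 2 <= #|[set p | dbl av p.1 p.2]|)%N.
Proof.
rewrite /n -size_filter.
apply: (card_fibre_pairs (pt := pt)); first by rewrite filter_uniq // undup_uniq.
move=> Q; rewrite mem_filter => /andP[/eqP Q2].
rewrite mem_undup => /mapP[[H L]]; rewrite mem_filter => /andP[/= HL].
move=> /allpairsP[[H' L'] /= [sH sL [eH eL]]] e; subst H' L'.
pose i : A := [` sH]%fset; pose j : A := [` sL]%fset.
have ij : i != j by rewrite -(inj_eq val_inj).
have ji : j != i by rewrite eq_sym.
have eji : pt j i = Q.
  have LH : L != H by rewrite eq_sym.
  apply/esym/eqP; rewrite -(on_meetE sL sH LH) andbC (on_meetE sH sL HL) e.
  exact: eqxx.
have eij : pt i j = Q by rewrite e.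
exists i, j; split=> //; apply: dbl_deg2 => //; rewrite ?eij ?eji -multE //.
Qed.

Lemma double_points_count : (n 2 = n 4 + 3)%N -> (5 < size s)%N ->
  (4 * n 2 <= (n 2 + 2 * n 3 + 3 * n 4).+1)%N.
Proof.
move=> n2E s5; have card_gt1 : (1 < #|{: A}|)%N by rewrite card_A size_gt1.
have card_gt2 : (2 < #|{: A}|)%N by rewrite card_A; move: s5; case: (size s) => [|[|[]]].
(* The assumption on [n 2] is precisely equality in Melchior's inequality. *)
have ext : (2 * \sum_(i : A) npoints pt i = 3 * (betti pt (enum {: A})).+1)%N.
  by rewrite betti_npoints points_count betti_A betti_count; lia.
have := double_points_le av_neq0 av_cross av_pt av_nontriv card_gt1 ext
  (no_near_pencil s5) card_gt2.
rewrite betti_A betti_count; move: double_count; lia.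
Qed.

Lemma betti_le : (2 < size s)%N ->
  free_curve (\prod_(H <- A) linform (map_mx (@real_complex R) (ell H))) ->
  (4 * betti meet s <= (size s).-1 ^ 2 + 4 * (size s).-1)%N.
Proof.
move=> s2 free; pose cav H := map_mx (real_complex R) (ell H).
apply: (@free_betti _ _ _ cav meet s s2 (fset_uniq A)) free.
- by move=> H sH; rewrite map_eq0 (ell_neq0 ellP).
- by move=> H L sH sL HL; rewrite cross_map map_eq0 (cross_neq0 ellP).
- move=> H L M sH sL sM LH MH; rewrite /vol cross_map dot_map fmorph_eq0.
  exact: meet_vol.
Qed.

End FreeRealArrangements.

Theorem theorem3p2 (R : realType) (d : nat) (A : {fset line R}) :
  #|` A| = d ->
  ~ trivial_arr A ->
  free_real_arr A ->
  (forall P : point R, mult A P <= 4) ->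
  3 <= d <= 18 /\
  (npts A 2, npts A 3, npts A 4) \in admissible_triples d.
Proof.
move=> dE nontriv [ell ellP free] mult4.
have [meet meetE] := meet_exists ellP.
have binE := bin2_count ellP meetE mult4.
have mel := melchior_count ellP meetE nontriv mult4.
have dbl := double_points_count ellP meetE nontriv mult4.
have betE := betti_count ellP meetE mult4.
have free_le := betti_le ellP meetE _ free.
rewrite !(npts_count ellP meetE) //.
move: binE mel dbl betE free_le; rewrite -dE.
move: (count _ _) (count _ _) (count _ _) (betti _ _) => n2 n3 n4 b.
change #|` A| with (size (enum_fset A)).
move: (size (enum_fset A)) => m binE mel dbl bE le.
(* Melchior's inequality gives at least three double points, while two lines have only one. *)
have m2 : 2 < m.
  rewrite ltnNge; apply/negP => m2.
  have : 'C(m, 2) <= 1 by case: (m) m2 => [|[|[]]].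
  by move: binE mel; lia.
apply: numeric_constraints_list => //; apply/and4P; split=> //.
- by rewrite -bin2 binE.
- by rewrite -bE; apply: le.
- by apply/implyP => /andP[/eqP]; exact: dbl.
Qed.
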